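(* Let $K$ be an algebraically closed field of characteristic $2$ and let $X\subset\mathbb{P}^3_K$ be a normal quartic surface given, in coordinates $(x_1,x_2,x_3,z)$, by an equation $$F(x,z)=\lambda z^4+z^2Q(x)+B(x)=0,$$ where $\lambda\in K$ and $Q,B\in K[x_1,x_2,x_3]$ are homogeneous of degrees $2$ and $4$. Then $|\mathrm{Sing}(X)|\le 16$.
   Context: Normal means irreducible with finitely many singular points. *)

(* Defs.v *)
From HB Require Import structures.
From mathcomp Require Import all_boot all_order all_algebra.
From mathcomp Require Import mpoly.
Set Implicit Arguments. Unset Strict Implicit. Unset Printing Implicit Defensive.
Import GRing.Theory.
Local Open Scope ring_scope.

(* Points of P^n are represented by nonzero vectors v : 'I_(n.+1) -> K,
   coordinates (x_1,x_2,x_3,z) of P^3 being indices 0,1,2,3. *)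

Definition proj_eq (K : fieldType) (n : nat) (p q : 'I_n -> K) : Prop :=
  exists2 c : K, c != 0 & forall i, q i = c * p i.

Definition mirreducible (K : fieldType) (n : nat) (F : {mpoly K[n]}) : Prop :=
  F \isn't a GRing.unit /\
  forall G H : {mpoly K[n]}, F = G * H -> G \is a GRing.unit \/ H \is a GRing.unit.

Definition is_sing_pt (K : fieldType) (n : nat) (F : {mpoly K[n]}) (v : 'I_n -> K) : Prop :=
  (exists i, v i != 0) /\ F.@[v] = 0 /\ forall i : 'I_n, (F^`M(i)).@[v] = 0.

Definition finitely_many_sing (K : fieldType) (n : nat) (F : {mpoly K[n]}) : Prop :=
  exists (N : nat) (f : 'I_N -> 'I_n -> K),
    forall v, is_sing_pt F v -> exists j, proj_eq (f j) v.

Definition normal_hypersurface (K : fieldType) (n : nat) (F : {mpoly K[n]}) : Prop :=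
  mirreducible F /\ finitely_many_sing F.

Definition quartic_F (K : fieldType) (lam : K) (Q B : {mpoly K[3]}) : {mpoly K[4]} :=
  lam *: 'X_(ord_max) ^+ 4 + 'X_(ord_max) ^+ 2 * mwiden Q + mwiden B.

(* Main.v *)
Require Import Defs.
From HB Require Import structures.
From mathcomp Require Import all_boot all_order all_algebra.
From mathcomp Require Import mpoly ring zify.
Import GRing.Theory.
Local Open Scope ring_scope.
Set Implicit Arguments. Unset Strict Implicit. Unset Printing Implicit Defensive.

(** In characteristic 2 write [m(x) = (x1 x2, x0 x2, x0 x1)], let [x^(2)] be
    the vector of squares, and split off even parts:
    [Q = k.m(x) + q(x^(2))] and [B = L x^(2) . m(x) + b(x^(2))].  Away from the
    apex [x = 0], which is singular only if [lam = 0], the gradient of [F]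
    vanishes exactly when [L x^(2) + z^2 k = mu x] for some [mu], and then
    [F = mu x0 x1 x2 + (polynomial in x^(2) and z^2)].

    If [k = 0], rescaling gives [x = L x^(2)] (or [L x^(2) = 0]); the solutions
    form an [F_2]-space of dimension at most 3, so there are at most 8 classes
    of [x], each carrying at most two values of [z^2], and only one if
    [lam = 0].

    If [k != 0], take [k] as third basis vector.  The third equation gives
    [z^2] rationally, and on the lines through [k] the first two give [mu] and
    [x2^2] (or, if [L k^(2)] is a multiple of [k], constrain the line by a
    binary cubic).  The square of [F] then becomes a polynomial in one
    variable, and adding up the degrees over the charts gives at most 14 points
    besides the apex.  A polynomial that vanishes identically produces
    infinitely many singular points. *)

Local Notation o0 := (@Ordinal 3 0 isT).
Local Notation o1 := (@Ordinal 3 1 isT).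
Local Notation o2 := (@Ordinal 3 2 isT).
Local Notation wd := (widen_ord (leqnSn 3)).

Lemma ord3P (P : 'I_3 -> Prop) : P o0 -> P o1 -> P o2 -> forall i, P i.
Proof.
by move=> P0 P1 P2 [[|[|[|i]]] lti] //=; rewrite (bool_irrelevance lti isT).
Qed.

Lemma ord4P (P : 'I_4 -> Prop) :
  P (wd o0) -> P (wd o1) -> P (wd o2) -> P ord_max -> forall i, P i.
Proof.
move=> P0 P1 P2 P3 [[|[|[|[|i]]]] lti] //=;
  [move: P0|move: P1|move: P2|move: P3]; congr P; exact: val_inj.
Qed.

Lemma sum3 (V : nmodType) (F : 'I_3 -> V) : \sum_i F i = F o0 + F o1 + F o2.
Proof.
rewrite !big_ord_recl big_ord0 addr0 addrA.
by congr (F _ + F _ + F _); apply: val_inj.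
Qed.

(** * Even and mixed parts of quadrics and quartics *)

Section Shape.
Variable K : fieldType.
Hypothesis charK : 2 \in [pchar K].
Implicit Types (v : 'I_4 -> K).

Lemma add2 (x : K) : x + x = 0.
Proof. exact: addrr_pchar2. Qed.

Definition sqv v (i : 'I_3) := v (wd i) ^+ 2.
Definition linf (R : comNzRingType) (q X : 'I_3 -> R) := \sum_i q i * X i.
Definition quadf (R : comNzRingType) (b : 'I_3 -> 'I_3 -> R) (X : 'I_3 -> R) :=
  \sum_i \sum_j b i j * (X i * X j).

Definition mixed v (y : 'I_3 -> K) :=
  y o0 * (v (wd o1) * v (wd o2)) + y o1 * (v (wd o0) * v (wd o2))
  + y o2 * (v (wd o0) * v (wd o1)).

(** Squares have zero derivative in characteristic 2, so if [y] depends on squares only, the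
    gradient of [mixed v y] is the cross product of [y] with the first three coordinates, signs
    being irrelevant. *)
Definition has_grad (P : {mpoly K[4]}) v (y : 'I_3 -> K) :=
  [/\ P^`M(wd o0).@[v] = y o1 * v (wd o2) + y o2 * v (wd o1),
      P^`M(wd o1).@[v] = y o0 * v (wd o2) + y o2 * v (wd o0),
      P^`M(wd o2).@[v] = y o0 * v (wd o1) + y o1 * v (wd o0) &
      P^`M(ord_max).@[v] = 0].

(** Stated on values and gradients at every point, the shape is stable under sums and multiples, so
    [homog_ind] reduces its existence to monomials. *)
Definition quadric_shape (P : {mpoly K[4]}) (k q : 'I_3 -> K) :=
  forall v, P.@[v] = mixed v k + linf q (sqv v) /\ has_grad P v k.

Definition quartic_shape (P : {mpoly K[4]}) (l b : 'I_3 -> 'I_3 -> K) :=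
  forall v, P.@[v] = mixed v (fun i => linf (l i) (sqv v)) + quadf b (sqv v)
    /\ has_grad P v (fun i => linf (l i) (sqv v)).

Lemma homog_ind (n d : nat) (P : {mpoly K[n]} -> Prop) (p : {mpoly K[n]}) :
  P 0 -> (forall p q, P p -> P q -> P (p + q)) -> (forall c p, P p -> P (c *: p)) ->
  (forall m, mdeg m = d -> P 'X_[m]) -> p \is d.-homog -> P p.
Proof.
move=> P0 PD PZ PX /dhomogP hp; rewrite [p]mpolyE big_seq.
by elim/big_ind: _ => // m mp; apply/PZ/PX/hp.
Qed.

Lemma mdegS_split (n d : nat) (m : 'X_{1..n}) :
  mdeg m = d.+1 -> exists i m', m = (U_(i) + m')%MM /\ mdeg m' = d.
Proof.
move=> hm; have [i mi] : exists i, m i != 0%N.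
  apply/existsP; apply: contra_eqT hm; rewrite negb_exists => /forallP h.
  suff -> : m = 0%MM by rewrite mdeg0.
  by apply/mnmP => i; rewrite mnm0E; apply/eqP; have := h i; rewrite negbK.
exists i, (m - U_(i))%MM.
have e : m = (U_(i) + (m - U_(i)))%MM by rewrite addmC submK // lep1mP.
split=> //; move: hm; rewrite {1}e mdegD mdeg1.
by rewrite add1n => -[].
Qed.

Lemma mderivXU (n : nat) (i j : 'I_n) : ('X_j : {mpoly K[n]})^`M(i) = (i == j)%:R.
Proof.
rewrite mderivX mnm1E eq_sym; case: eqP => [->|_]; last by rewrite scale0r.
have -> : (U_(j) - U_(j))%MM = 0%MM by apply/mnmP => k; rewrite mnmBE subnn mnm0E.
by rewrite mpolyX0 scale1r.
Qed.

Lemma quadric_shapeXX (i j : 'I_3) :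
  exists k q, quadric_shape ('X_(wd i) * 'X_(wd j)) k q.
Proof.
(* A product of two distinct coordinates is mixed, with [k] supported at the third index; a square
   contributes to [q] only. *)
exists (fun a => ((i != j) && (a != i) && (a != j))%:R).
exists (fun a => ((i == j) && (a == i))%:R).
move=> v; rewrite /linf sum3 /has_grad /mixed /sqv.
rewrite !mderivM !mevalD !mevalM !mderivXU !mevalXU.
elim/ord3P: i; elim/ord3P: j; rewrite /= ?mevalC ?meval1 ?meval0;
  do ?split; rewrite ?mul0r ?mul1r ?mulr0 ?mulr1 ?add0r ?addr0 ?add2 //; 
  try ring.
Qed.

Lemma linfD (R : comNzRingType) (p q X : 'I_3 -> R) :
  linf (fun i => p i + q i) X = linf p X + linf q X.
Proof. by rewrite /linf -big_split; apply: eq_bigr => i _; rewrite mulrDl. Qed.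

Lemma linfZ (R : comNzRingType) c (q X : 'I_3 -> R) :
  linf (fun i => c * q i) X = c * linf q X.
Proof. by rewrite /linf mulr_sumr; apply: eq_bigr => i _; rewrite mulrA. Qed.

Lemma linf0 (R : comNzRingType) (X : 'I_3 -> R) : linf (fun=> 0) X = 0.
Proof. by rewrite /linf big1 // => i _; rewrite mul0r. Qed.

Lemma quadfE (R : comNzRingType) (b : 'I_3 -> 'I_3 -> R) X :
  quadf b X = linf (fun i => linf (b i) X) X.
Proof.
apply: eq_bigr => i _; rewrite mulr_suml; apply: eq_bigr => j _.
by rewrite -mulrA (mulrC (X j)).
Qed.

Lemma has_gradD P P' v y y' :
  has_grad P v y -> has_grad P' v y' -> has_grad (P + P') v (fun i => y i + y' i).
Proof.
move=> [g0 g1 g2 g3] [h0 h1 h2 h3].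
by split; rewrite mderivD mevalD ?g0 ?h0 ?g1 ?h1 ?g2 ?h2 ?g3 ?h3; ring.
Qed.

Lemma has_gradZ c P v y : has_grad P v y -> has_grad (c *: P) v (fun i => c * y i).
Proof.
by move=> [g0 g1 g2 g3]; split; rewrite mderivZ mevalZ ?g0 ?g1 ?g2 ?g3; ring.
Qed.

Lemma has_grad_eq P v y y' : y =1 y' -> has_grad P v y -> has_grad P v y'.
Proof. by move=> e [*]; split; rewrite -?e. Qed.

(** A square behaves as a constant: the product rule differentiates it to two equal terms, which
    cancel. *)
Lemma has_grad_sqM i P v y :
  has_grad P v y -> has_grad ('X_i ^+ 2 * P) v (fun j => v i ^+ 2 * y j).
Proof.
have d j : ('X_i ^+ 2 * P)^`M(j).@[v] = v i ^+ 2 * P^`M(j).@[v].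
  rewrite expr2 !mderivM !(mevalD, mevalM) !mevalXU [X in (X + _) * _](mulrC).
  by rewrite add2 mul0r add0r.
by move=> [g0 g1 g2 g3]; split; rewrite d ?g0 ?g1 ?g2 ?g3; ring.
Qed.

Lemma mixedD v y y' : mixed v (fun i => y i + y' i) = mixed v y + mixed v y'.
Proof. by rewrite /mixed; ring. Qed.

Lemma mixedZ v c y : mixed v (fun i => c * y i) = c * mixed v y.
Proof. by rewrite /mixed; ring. Qed.

Lemma mixed_eq v y y' : y =1 y' -> mixed v y = mixed v y'.
Proof. by move=> e; rewrite /mixed !e. Qed.

Lemma quadricP (Q : {mpoly K[3]}) :
  Q \is 2.-homog -> exists k q, quadric_shape (mwiden Q) k q.
Proof.
elim/homog_ind => [|p p' [k [q h]] [k' [q' h']]|c p [k [q h]]|m].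
- exists (fun=> 0), (fun=> 0) => v; rewrite mwiden0 meval0 linf0 /mixed !mul0r !addr0.
  by split=> //; split; rewrite mderiv0 meval0 ?mul0r ?addr0.
- exists (fun i => k i + k' i), (fun i => q i + q' i) => v.
  have [e g] := h v; have [e' g'] := h' v; split.
    by rewrite mwidenD mevalD e e' linfD mixedD addrACA.
  by rewrite mwidenD; exact: has_gradD.
- exists (fun i => c * k i), (fun i => c * q i) => v.
  have [e g] := h v; split; first by rewrite mwidenZ mevalZ e linfZ mixedZ mulrDr.
  by rewrite mwidenZ; exact: has_gradZ.
move=> /mdegS_split [i [m' [-> /mdegS_split [j [m'' [-> /eqP]]]]]].
rewrite mdeg_eq0 => /eqP ->; rewrite addm0 mpolyXD mwidenM !mwidenX !mnmwiden1.
exact: quadric_shapeXX.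
Qed.

Lemma quartic_shape_sqM (i : 'I_3) (P : {mpoly K[4]}) (k q : 'I_3 -> K) :
  quadric_shape P k q ->
  quartic_shape ('X_(wd i) ^+ 2 * P) (fun a c => k a * (c == i)%:R)
                                     (fun a c => (a == i)%:R * q c).
Proof.
move=> h v; have [e g] := h v.
have L a : linf (fun c => k a * (c == i)%:R) (sqv v) = v (wd i) ^+ 2 * k a.
  rewrite linfZ mulrC; congr (_ * _); rewrite /linf (bigD1 i) //= eqxx mul1r.
  by rewrite big1 ?addr0 // => j /negPf ->; rewrite mul0r.
split; last by apply: has_grad_eq (has_grad_sqM _ g) => a; rewrite L.
rewrite mevalM e !rmorphXn /= !mevalXU mulrDr (mixed_eq v L) mixedZ; congr (_ + _).
rewrite quadfE; rewrite [RHS]/linf (bigD1 i) //= linfZ eqxx mul1r mulrC.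
by rewrite big1 ?addr0 // => j /negPf ne; rewrite linfZ ne !mul0r.
Qed.

(** Two of four indices among three values coincide, so a square of a coordinate splits off every
    quartic monomial. *)
Lemma quartic_shapeXXXX (a b c d : 'I_3) :
  exists l e : 'I_3 -> 'I_3 -> K,
    quartic_shape ('X_(wd a) * ('X_(wd b) * ('X_(wd c) * 'X_(wd d)))) l e.
Proof.
have Q i j k :
    exists l e : 'I_3 -> 'I_3 -> K, quartic_shape ('X_(wd i) ^+ 2 * ('X_(wd j) * 'X_(wd k))) l e.
  have [k' [q h]] := quadric_shapeXX j k.
  by do 2 eexists; exact: quartic_shape_sqM h.
have [->|ab] := eqVneq a b.
  by have [l [e h]] := Q b c d; exists l, e; move: h; rewrite expr2 !mulrA.
have [->|ac] := eqVneq a c.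
  by have [l [e h]] := Q c b d; exists l, e; move: h; congr quartic_shape; ring.
have [->|ad] := eqVneq a d.
  by have [l [e h]] := Q d b c; exists l, e; move: h; congr quartic_shape; ring.
have [->|bc] := eqVneq b c.
  by have [l [e h]] := Q c a d; exists l, e; move: h; congr quartic_shape; ring.
have [->|bd] := eqVneq b d.
  by have [l [e h]] := Q d a c; exists l, e; move: h; congr quartic_shape; ring.
have [->|cd] := eqVneq c d.
  by have [l [e h]] := Q d a b; exists l, e; move: h; congr quartic_shape; ring.
by exfalso; move: ab ac ad bc bd cd; elim/ord3P: a; elim/ord3P: b => //;
  elim/ord3P: c => //; elim/ord3P: d.
Qed.

Lemma quarticP (B : {mpoly K[3]}) :
  B \is 4.-homog -> exists l b, quartic_shape (mwiden B) l b.
Proof.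
elim/homog_ind => [|p p' [k [q h]] [k' [q' h']]|c p [k [q h]]|m].
- exists (fun=> fun=> 0), (fun=> fun=> 0) => v; rewrite mwiden0 meval0.
  have e : quadf (fun _ _ => 0) (sqv v) = 0.
    by rewrite /quadf big1 // => i _; rewrite big1 // => j _; rewrite mul0r.
  rewrite e /mixed !linf0 !mul0r !addr0; split=> //.
  by split; rewrite mderiv0 meval0 ?linf0 ?mul0r ?addr0.
- exists (fun i j => k i j + k' i j), (fun i j => q i j + q' i j) => v.
  have [e g] := h v; have [e' g'] := h' v; split.
    rewrite mwidenD mevalD e e' (mixed_eq _ (fun i => linfD (k i) (k' i) _)) mixedD addrACA.
    congr (_ + _); rewrite !quadfE -linfD; apply: eq_bigr => i _.
    by rewrite linfD.
  rewrite mwidenD; apply: has_grad_eq (has_gradD g g') => i.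
  by rewrite linfD.
- exists (fun i j => c * k i j), (fun i j => c * q i j) => v.
  have [e g] := h v; split.
    rewrite mwidenZ mevalZ e (mixed_eq _ (fun i => linfZ c (k i) _)) mixedZ mulrDr.
    congr (_ + _); rewrite !quadfE -linfZ; apply: eq_bigr => i _.
    by rewrite linfZ.
  rewrite mwidenZ; apply: has_grad_eq (has_gradZ c g) => i.
  by rewrite linfZ.
move=> /mdegS_split [i [m' [-> /mdegS_split [j [m'' [->]]]]]].
move=> /mdegS_split [a [m3 [-> /mdegS_split [b [m4 [-> /eqP]]]]]].
rewrite mdeg_eq0 => /eqP ->; rewrite addm0 !mpolyXD !mwidenM !mwidenX !mnmwiden1.
exact: quartic_shapeXXXX.
Qed.

End Shape.

(** * Singular points as solutions of a Frobenius-semilinear system *)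

Section Sys.
Variable K : fieldType.
Hypothesis charK : 2 \in [pchar K].
Implicit Types (v : 'I_4 -> K).
Local Notation add2 := (add2 charK).

Definition sq (m n : nat) (A : 'M[K]_(m, n)) := map_mx (fun a => a ^+ 2) A.

Definition prodc (x : 'cV[K]_3) := x o0 0 * x o1 0 * x o2 0.

Definition evenpart (lam : K) q b (x : 'cV[K]_3) (w : K) :=
  lam * w ^+ 2 + w * linf q ((sq x)^~ 0) + quadf b ((sq x)^~ 0).

(* The singular points [(x : z)] with [x != 0] of
   [lam z^4 + z^2 Q + B], where [Q = mixed k + q(x^(2))] and
   [B = mixed (L x^(2)) + b(x^(2))]: the gradient is the cross product of [x]
   with [L x^(2) + z^2 k], and when that vector equals [mu x] its mixed part
   is [3 mu x0 x1 x2 = mu x0 x1 x2]. *)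
Definition sing_sys (L : 'M[K]_3) (k : 'cV[K]_3) lam q b (x : 'cV[K]_3) (z : K) :=
  x != 0 /\ exists mu, L *m sq x + z ^+ 2 *: k = mu *: x
    /\ mu * prodc x + evenpart lam q b x (z ^+ 2) = 0.

(** Index 3 lies outside the list, so the default value of [nth] supplies the last coordinate. *)
Definition space_pt (x : 'cV[K]_3) (z : K) (i : 'I_4) : K :=
  nth z [:: x o0 0; x o1 0; x o2 0] i.

Lemma cV3P (x y : 'cV[K]_3) :
  x o0 0 = y o0 0 -> x o1 0 = y o1 0 -> x o2 0 = y o2 0 -> x = y.
Proof.
by move=> e0 e1 e2; apply/matrixP => i j; rewrite !ord1; elim/ord3P: i.
Qed.

Lemma cV3_neq0 (x : 'cV[K]_3) : x != 0 -> exists i, x i 0 != 0.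
Proof.
move=> x0; apply/existsP; apply: contraNT x0; rewrite negb_exists => /forallP h.
by apply/eqP/matrixP => i j; rewrite !ord1 mxE; apply/eqP; have := h i; rewrite negbK.
Qed.

Lemma colinear (x y : 'cV[K]_3) : x != 0 ->
  (forall i j, y i 0 * x j 0 = y j 0 * x i 0) -> exists mu, y = mu *: x.
Proof.
move=> /cV3_neq0 [i xi] h; exists (y i 0 / x i 0).
apply/matrixP => j a; rewrite ord1 mxE mulrAC h mulfK //.
Qed.

Lemma eq_add2 (x y : K) : (x + y = 0) <-> x = y.
Proof.
split=> [/eqP|->]; last exact: add2.
by rewrite addr_eq0 => /eqP ->; rewrite (oppr_pchar2 charK).
Qed.

Section Quartic.
Variables (lam : K) (Q B : {mpoly K[3]}) (k q : 'I_3 -> K) (l b : 'I_3 -> 'I_3 -> K).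
Hypothesis (hQ : quadric_shape (mwiden Q) k q) (hB : quartic_shape (mwiden B) l b).

Let L := \matrix_(i, j) l i j.
Let kc := \col_i k i.

Definition base_pt v : 'cV[K]_3 := \col_i v (wd i).

Lemma quartic_eval v (y := L *m sq (base_pt v) + v ord_max ^+ 2 *: kc) :
  (quartic_F lam Q B).@[v] =
    mixed v (y^~ 0) + evenpart lam q b (base_pt v) (v ord_max ^+ 2)
  /\ has_grad (quartic_F lam Q B) v (y^~ 0).
Proof.
have [eQ gQ] := hQ v; have [eB gB] := hB v.
have eX : (sq (base_pt v))^~ 0 =1 sqv v by move=> i; rewrite !mxE.
have ey i : y i 0 = v ord_max ^+ 2 * k i + linf (l i) (sqv v).
  rewrite !mxE addrC; congr (_ + _); apply: eq_bigr => j _.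
  by rewrite mxE eX.
split.
  have mX n : (('X_ord_max : {mpoly K[4]}) ^+ n).@[v] = v ord_max ^+ n.
    by rewrite rmorphXn /= mevalXU.
  rewrite /quartic_F !mevalD mevalZ mX mevalM mX eQ eB.
  rewrite (mixed_eq v ey) mixedD mixedZ /evenpart.
  have -> : linf q ((sq (base_pt v))^~ 0) = linf q (sqv v).
    by apply: eq_bigr => i _; rewrite eX.
  have -> : quadf b ((sq (base_pt v))^~ 0) = quadf b (sqv v).
    by apply: eq_bigr => i _; apply: eq_bigr => j _; rewrite !eX.
  by ring.
apply: (@has_grad_eq _ _ _ (fun i => v ord_max ^+ 2 * k i + linf (l i) (sqv v))).
  by move=> i; rewrite ey.
apply: has_gradD gB.
have := has_gradD (P := lam *: 'X_ord_max ^+ 4) (y := fun=> 0) _ (has_grad_sqM charK ord_max gQ).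
move=> h; apply: has_grad_eq (h _) => [i|]; first by rewrite add0r.
have d j : (lam *: ('X_ord_max : {mpoly K[4]}) ^+ 4)^`M(j).@[v] = 0.
  rewrite mderivZ mevalZ (_ : _ ^+ 4 = 'X_ord_max ^+ 2 * 'X_ord_max ^+ 2); last by ring.
  by rewrite mderivM mevalD [X in X.@[v] + _]mulrC add2 mulr0.
by split; rewrite d ?mul0r ?addr0.
Qed.

Lemma mixed_colinear v mu : mixed v (fun i => mu * base_pt v i 0) = mu * prodc (base_pt v).
Proof.
rewrite /mixed /prodc !mxE.
set p := mu * (_ * _ * _).
have := add2 p => h; transitivity (p + (p + p)); last by rewrite h addr0.
by rewrite /p; ring.
Qed.

Lemma sing_sysP v : is_sing_pt (quartic_F lam Q B) v ->
  base_pt v = 0 /\ lam = 0 /\ v ord_max != 0 \/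
  sing_sys L kc lam q b (base_pt v) (v ord_max).
Proof.
have [+ +] := quartic_eval v; set y := L *m _ + _.
move=> eF [g0 g1 g2 g3] [[a va] [F0 dF]].
have [x0|x0] := eqVneq (base_pt v) 0.
  left; have vi i : v (wd i) = 0.
    by have /matrixP/(_ i 0) := x0; rewrite !mxE.
  have z0 : v ord_max != 0.
    by move: va; elim/ord4P: a => //; rewrite vi eqxx.
  split=> //; split=> //; move: F0; rewrite eF /mixed !vi x0.
  have s0 : (sq (0 : 'cV[K]_3))^~ 0 =1 (fun=> 0).
    by move=> i; rewrite !mxE expr0n.
  rewrite /evenpart /linf /quadf !sum3 !s0 !(mulr0, addr0, add0r) => /eqP.
  by rewrite mulf_eq0 -exprM expf_eq0 (negPf z0) /= orbF => /eqP.
right; split=> //.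
(* The first three partial derivatives are the components of the cross product of [y] and the base
   point. *)
have c i j : y i 0 * base_pt v j 0 = y j 0 * base_pt v i 0.
  move: (dF (wd o0)) (dF (wd o1)) (dF (wd o2)); rewrite g0 g1 g2.
  move=> /eq_add2 h0 /eq_add2 h1 /eq_add2 h2.
  rewrite ![base_pt _ _ _]mxE; elim/ord3P: i; elim/ord3P: j => //.
have [mu e] := colinear x0 c; exists mu; split=> //.
rewrite -F0 eF; congr (_ + _); rewrite -mixed_colinear; apply: mixed_eq => i.
by rewrite e [RHS]mxE.
Qed.

Lemma space_ptK x z : base_pt (space_pt x z) = x.
Proof. by apply: cV3P; rewrite mxE. Qed.

(** This converse turns an infinite family of solutions into infinitely many singular points, which
    is how identically vanishing polynomials are excluded later. *)
Lemma sys_sing x z :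
  sing_sys L kc lam q b x z -> is_sing_pt (quartic_F lam Q B) (space_pt x z).
Proof.
case=> x0 [mu [e h]].
have [] := quartic_eval (space_pt x z); rewrite space_ptK {2 5}/space_pt /= e.
set v := space_pt x z => eF [g0 g1 g2 g3]; split.
  by have [i xi] := cV3_neq0 x0; exists (wd i); elim/ord3P: i xi.
split.
  rewrite eF -[RHS]h; congr (_ + _).
  have -> : mu * prodc x = mixed v (fun i => mu * base_pt v i 0).
    by rewrite mixed_colinear space_ptK.
  by apply: mixed_eq => i; rewrite [LHS]mxE space_ptK.
elim/ord4P => //; rewrite ?g0 ?g1 ?g2; apply/eq_add2;
rewrite /v /space_pt /= ![(mu *: x) _ _]mxE -!mulrA; congr (_ * _); exact: mulrC.
Qed.
End Quartic.
End Sys.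

(** * Finiteness and counting *)

Section Counting.
Variable K : closedFieldType.
Implicit Types (S : 'cV[K]_3 -> K -> Prop).

(* No infinite family of points of [S]: the parameter [t] avoids finitely many
   values and is determined by the projective point through [P]. *)
Definition no_family S := forall (s : {poly K}) (P : K -> 'cV[K]_3 -> K -> Prop),
  s != 0 ->
  (forall t, ~~ root s t -> exists x z, S x z /\ P t x z) ->
  (forall t t' x x' z z' c, c != 0 -> P t x z -> P t' x' z' ->
    x' = c *: x -> z' = c * z -> t = t') ->
  False.

Lemma non_roots (s : {poly K}) n : s != 0 ->
  exists t : 'I_n -> K, injective t /\ forall i, ~~ root s (t i).
Proof.
move=> s0; suff [r [ur sr hr]] : exists r : seq K,
    [/\ uniq r, size r = n & all (fun t => ~~ root s t) r].
  exists (fun i => r`_i); split=> [i j /eqP|i].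
    by rewrite nth_uniq ?sr // => /eqP /val_inj.
  by apply: (allP hr); rewrite mem_nth ?sr.
elim: n => [|n [r [ur sr hr]]]; first by exists [::].
have : s * \prod_(t <- r) ('X - t%:P) != 0.
  by rewrite mulf_neq0 // monic_neq0 // monic_prod_XsubC.
case/closed_nonrootP => t; rewrite rootM root_prod_XsubC negb_or => /andP [st tr].
by exists (t :: r); rewrite /= tr ur sr st hr.
Qed.

(** Pigeonhole: among [N.+1] parameters outside the roots of [s], two give the same one of [N]
    projective points, although the family separates parameters. *)
Lemma finite_no_family (F : {mpoly K[4]}) S :
  (forall x z, S x z -> is_sing_pt F (space_pt x z)) ->
  finitely_many_sing F -> no_family S.
Proof.
move=> hS [N [f hf]] s P s0 hP injP.
have [t [injt ht]] := non_roots N.+1 s0.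
have ex i : exists j, exists x z, P (t i) x z /\ proj_eq (f j) (space_pt x z).
  have [x [z [/hS /hf [j hj] p]]] := hP _ (ht i).
  by exists j, x, z.
have [h hh] := fin_all_exists ex.
suff injh : injective h by have := leq_card h injh; rewrite !card_ord ltnn.
move=> i i' e; apply: injt.
have [x [z [p [c c0 e1]]]] := hh i; have [x' [z' [p' [c' c'0]]]] := hh i'.
rewrite -e => e2.
have key j : space_pt x' z' j = c' / c * space_pt x z j.
  by rewrite e1 e2 mulrA mulfVK.
apply: (injP _ _ x x' z z' (c' / c) _ p p').
- by rewrite mulf_neq0 // invr_eq0.
- apply: cV3P; rewrite mxE.
  + exact: (key (wd o0)).
  + exact: (key (wd o1)).
  + exact: (key (wd o2)).
- exact: (key ord_max).
Qed.

Lemma card_roots (T : finType) (A : {set T}) (f : T -> K) (p : {poly K}) d :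
  p != 0 -> (size p <= d.+1)%N -> {in A, forall j, root p (f j)} ->
  {in A &, injective f} -> (#|A| <= d)%N.
Proof.
move=> p0 sp hr injf; rewrite cardE -(size_map f) -ltnS.
apply: leq_trans sp; apply: max_poly_roots p0 _ _.
  by apply/allP => _ /mapP [j + ->]; rewrite mem_enum => /hr.
by rewrite map_inj_in_uniq ?enum_uniq // => i j; rewrite !mem_enum; exact: injf.
Qed.

(** The list [r] may have repeated entries, so roots listed with multiplicity are allowed. *)
Lemma card_fibers (T : finType) (U : eqType) (A : {set T}) (f : T -> U) (r : seq U) d :
  {in A, forall j, f j \in r} ->
  (forall u, u \in r -> (#|[set j in A | f j == u]| <= d)%N) ->
  (#|A| <= size r * d)%N.
Proof.
elim: r A => [|u r IH] A hA hd.
  suff -> : A = set0 by rewrite cards0.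
  by apply/setP => j; rewrite inE; apply/negP => /hA.
rewrite -(cardsID [set j | f j == u] A) mulSn leq_add //.
  apply: leq_trans (hd u (mem_head _ _)); apply: subset_leq_card.
  by apply/subsetP => j; rewrite !inE.
apply: IH => [j|v vr].
  rewrite !inE => /andP [/negPf ju /hA]; by rewrite inE ju.
apply: leq_trans (hd v _); last by rewrite inE vr orbT.
by apply: subset_leq_card; apply/subsetP => j; rewrite !inE -andbA => /and3P [_ -> ->].
Qed.

Lemma sqrt_exists (a : K) : exists s, s ^+ 2 = a.
Proof.
have /closed_rootP [s] : size ('X^2 - a%:P : {poly K}) != 1%N by rewrite size_XnsubC.
rewrite /root !hornerE subr_eq0 => /eqP <-; by exists s.
Qed.

Hypothesis charK : 2 \in [pchar K].

Lemma sqr2D (x y : K) : (x + y) ^+ 2 = x ^+ 2 + y ^+ 2.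
Proof. by rewrite sqrrD mulr2n (add2 charK) addr0. Qed.

Lemma sqr2_inj (x y : K) : x ^+ 2 = y ^+ 2 -> x = y.
Proof.
move=> e; apply/(eq_add2 charK)/eqP.
have : (x + y) ^+ 2 == 0 by rewrite sqr2D e (add2 charK).
by rewrite expf_eq0.
Qed.

Lemma sqM (m n p : nat) (A : 'M[K]_(m, n)) (B : 'M[K]_(n, p)) : sq (A *m B) = sq A *m sq B.
Proof.
have := map_mxM (pFrobenius_aut charK) A B.
by rewrite /sq.
Qed.

Lemma sqZ (m n : nat) c (A : 'M[K]_(m, n)) : sq (c *: A) = c ^+ 2 *: sq A.
Proof. by apply/matrixP => i j; rewrite !mxE exprMn. Qed.

Lemma sqD (m n : nat) (A B : 'M[K]_(m, n)) : sq (A + B) = sq A + sq B.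
Proof. by apply/matrixP => i j; rewrite !mxE sqr2D. Qed.

Lemma evenpartZ (lam : K) q b c x w :
  evenpart lam q b (c *: x) (c ^+ 2 * w) = c ^+ 4 * evenpart lam q b x w.
Proof.
rewrite /evenpart /linf /quadf !sum3 !sqZ ![(c ^+ 2 *: sq x) _ _]mxE.
by ring.
Qed.

Lemma sing_sysZ L k lam q b (x : 'cV[K]_3) z c : c != 0 ->
  sing_sys L k lam q b x z -> sing_sys L k lam q b (c *: x) (c * z).
Proof.
move=> c0 [x0 [mu [e h]]]; split; first by rewrite scaler_eq0 negb_or c0.
exists (c * mu); split.
  rewrite sqZ -scalemxAr exprMn -[(c ^+ 2 * _) *: k]scalerA -scalerDr e !scalerA.
  by congr (_ *: _); ring.
rewrite exprMn evenpartZ; apply: etrans (_ : c ^+ 4 * 0 = 0); last by rewrite mulr0.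
by rewrite -h /prodc !mxE; ring.
Qed.

End Counting.

(** * Elimination when the quadric is not a square *)

(** With this bound on the size, the zero polynomial satisfies every degree bound. *)
Definition deg_le (R : nzRingType) (p : {poly R}) d := (size p <= d.+1)%N.

Section DegLe.
Variable R : idomainType.
Implicit Types p q : {poly R}.

Lemma deg_leW p d e : (d <= e)%N -> deg_le p d -> deg_le p e.
Proof. by move=> de; rewrite /deg_le => h; apply: leq_trans h _; rewrite ltnS. Qed.

Lemma deg_leD p q d : deg_le p d -> deg_le q d -> deg_le (p + q) d.
Proof. by move=> hp hq; apply: leq_trans (size_polyD _ _) _; rewrite geq_max; apply/andP. Qed.

Lemma deg_leM p q d e : deg_le p d -> deg_le q e -> deg_le (p * q) (d + e).
Proof.
rewrite /deg_le => hp hq; apply: leq_trans (size_polyMleq _ _) _.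
by rewrite -ltnS; case: (size p + size q)%N (leq_add hp hq) => // k; rewrite addSn addnS.
Qed.

Lemma deg_leX p d k : deg_le p d -> deg_le (p ^+ k) (k * d).
Proof.
move=> hp; elim: k => [|k IH]; first by rewrite expr0 /deg_le size_poly1.
by rewrite exprS mulSn deg_leM.
Qed.

Lemma deg_leC (c : R) d : deg_le c%:P d.
Proof. by rewrite /deg_le (leq_trans (size_polyC_leq1 _)). Qed.

Lemma deg_leCM (c : R) p d : deg_le p d -> deg_le (c%:P * p) d.
Proof. by move=> h; rewrite -[d]add0n deg_leM // deg_leC. Qed.

Lemma deg_le_linf (q X : 'I_3 -> {poly R}) d :
  (forall i, deg_le (q i) 0) -> (forall i, deg_le (X i) d) -> deg_le (linf q X) d.
Proof.
move=> hq hX; rewrite /linf sum3 -[d]add0n.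
by rewrite !deg_leD // deg_leM.
Qed.

Lemma deg_le_quadf (b : 'I_3 -> 'I_3 -> {poly R}) X d :
  (forall i j, deg_le (b i j) 0) -> (forall i, deg_le (X i) d) ->
  deg_le (quadf b X) (2 * d).
Proof.
move=> hb hX; rewrite /quadf !sum3 -[(2 * d)%N]add0n mul2n -addnn.
by rewrite !deg_leD // !deg_leM.
Qed.
End DegLe.

Lemma quadratic_root (K : closedFieldType) (c2 c1 c0 : K) : (c2 != 0) || (c1 != 0) ->
  exists u, c2 * u ^+ 2 + c1 * u + c0 = 0.
Proof.
have [->|c2n _] := eqVneq c2 0.
  by move=> /= c1n; exists (- c0 / c1); rewrite mul0r add0r mulrC divfK // addNr.
have /closed_rootP [u] : size (c2 *: 'X^2 + (c1 *: 'X + c0%:P)) != 1%N.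
  rewrite size_polyDl size_scale // ?size_polyXn //.
  rewrite ltnS; apply: deg_leD; last exact: deg_leC.
  by rewrite -mul_polyC deg_leCM // /deg_le size_polyX.
by rewrite /root !(hornerXn, hornerX, hornerC, hornerD, hornerZ) addrA => /eqP; exists u.
Qed.

Definition col3 (K : nmodType) (a b c : K) : 'cV[K]_3 := \col_i nth 0 [:: a; b; c] i.

(** * The system in a basis containing [k], and its eliminant *)

Section Reduced.
Variable K : closedFieldType.
Hypothesis charK : 2 \in [pchar K].
Variables (M n : 'M[K]_3) (lam : K) (q : 'I_3 -> K) (b : 'I_3 -> 'I_3 -> K).
Implicit Types (y : 'cV[K]_3) (z : K).

(** Here [x = n *m y], where [k] is to be the third column of [n]; the matching [M] is given in
    [reduced_sysE]. *)
Definition reduced_sys y z :=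
  y != 0 /\ exists mu, M *m sq y + z ^+ 2 *: col3 0 0 1 = mu *: y
    /\ mu * prodc (n *m y) + evenpart lam q b (n *m y) (z ^+ 2) = 0.

Section Eliminant.
Variables (R : comNzRingType) (io : K -> R) (mu Y0 Y1 Y2 : R).
Let X i := io (n i o0 ^+ 2) * Y0 + io (n i o1 ^+ 2) * Y1 + io (n i o2 ^+ 2) * Y2.
Let G := io (M o2 o0) * Y0 + io (M o2 o1) * Y1 + io (M o2 o2) * Y2.
Let W := mu ^+ 2 * Y2 + G ^+ 2.

(* The square of [mu * prodc (n *m y) + evenpart lam q b (n *m y) w] as a
   function of [mu] and the squares [Yi] of the coordinates of [y], where
   [W] is the square of [w = mu * y2 + G]. *)
Definition eliminant :=
  mu ^+ 2 * (X o0 * X o1 * X o2) + io lam ^+ 2 * W ^+ 2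
  + W * linf (io \o q) X ^+ 2 + quadf (fun i => io \o b i) X ^+ 2.
End Eliminant.

Lemma col3_eta y : y = col3 (y o0 0) (y o1 0) (y o2 0).
Proof. by apply: cV3P; rewrite mxE. Qed.

Lemma mulmx_sqE (A : 'M[K]_3) y i :
  (A *m sq y) i 0 = A i o0 * y o0 0 ^+ 2 + A i o1 * y o1 0 ^+ 2 + A i o2 * y o2 0 ^+ 2.
Proof. by rewrite mxE sum3 !mxE. Qed.

(** Frobenius is additive, so squaring acts term by term and leaves only squares of coordinates of
    [y]; being injective, it loses no information. *)
Lemma eliminantE mu y (w := mu * y o2 0 + (M *m sq y) o2 0) :
  eliminant id mu (y o0 0 ^+ 2) (y o1 0 ^+ 2) (y o2 0 ^+ 2) =
  (mu * prodc (n *m y) + evenpart lam q b (n *m y) w) ^+ 2.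
Proof.
have hX i : n i o0 ^+ 2 * y o0 0 ^+ 2 + n i o1 ^+ 2 * y o1 0 ^+ 2 +
             n i o2 ^+ 2 * y o2 0 ^+ 2 = sq (n *m y) i 0.
  by rewrite sqM // mulmx_sqE !mxE.
rewrite /eliminant !hX -(mulmx_sqE M y o2).
have -> : mu ^+ 2 * y o2 0 ^+ 2 + (M *m sq y) o2 0 ^+ 2 = w ^+ 2.
  by rewrite /w (sqr2D charK) exprMn.
clearbody w.
rewrite /evenpart !(sqr2D charK) !addrA; congr (_ + _ + _ + _).
- by rewrite [RHS]exprMn /prodc 2!exprMn !mxE.
- by rewrite [RHS]exprMn.
- by rewrite [RHS]exprMn; congr (_ * _ ^+ 2); apply: eq_bigr => i _; rewrite hX.
- by congr (_ ^+ 2); apply: eq_bigr => i _; apply: eq_bigr => j _; rewrite !hX.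
Qed.

Lemma reduced_sysP y z : reduced_sys y z -> exists mu,
  [/\ mu * y o0 0 = (M *m sq y) o0 0, mu * y o1 0 = (M *m sq y) o1 0,
      z ^+ 2 = mu * y o2 0 + (M *m sq y) o2 0 &
      eliminant id mu (y o0 0 ^+ 2) (y o1 0 ^+ 2) (y o2 0 ^+ 2) = 0].
Proof.
case=> y0 [mu [/matrixP e h]]; exists mu.
have z2 : z ^+ 2 = mu * y o2 0 + (M *m sq y) o2 0.
  have := e o2 0; rewrite !mxE mulr1 => <-.
  by rewrite addrAC (add2 charK) add0r.
split=> //.
- by have := e o0 0; rewrite !mxE mulr0 addr0.
- by have := e o1 0; rewrite !mxE mulr0 addr0.
- by rewrite eliminantE -z2 h expr0n.
Qed.

(** The third equation merely prescribes [z^2], and [K] contains square roots. *)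
Lemma reduced_sys_exists mu y : y != 0 ->
  mu * y o0 0 = (M *m sq y) o0 0 -> mu * y o1 0 = (M *m sq y) o1 0 ->
  eliminant id mu (y o0 0 ^+ 2) (y o1 0 ^+ 2) (y o2 0 ^+ 2) = 0 ->
  exists z, reduced_sys y z.
Proof.
move=> y0 e0 e1 h; have [z z2] := sqrt_exists (mu * y o2 0 + (M *m sq y) o2 0).
exists z; split=> //; exists mu; split.
  apply: cV3P; rewrite !mxE ?mulr0 ?addr0 ?mulr1.
  - by rewrite e0 !mxE.
  - by rewrite e1 !mxE.
  by rewrite z2 !mxE addrCA (add2 charK) addr0.
by apply/eqP; move: h; rewrite eliminantE z2 => /eqP; rewrite expf_eq0.
Qed.

Lemma horner_linf (p : 'I_3 -> K) (X : 'I_3 -> {poly K}) t :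
  (linf (polyC \o p) X).[t] = linf (id \o p) (fun i => (X i).[t]).
Proof. by rewrite horner_sum; apply: eq_bigr => i _; rewrite hornerM hornerC. Qed.

Lemma horner_quadf (X : 'I_3 -> {poly K}) t :
  (quadf (fun i => polyC \o b i) X).[t] = quadf (fun i => id \o b i) (fun i => (X i).[t]).
Proof.
rewrite horner_sum; apply: eq_bigr => i _; rewrite horner_sum; apply: eq_bigr => j _.
by rewrite !hornerM hornerC.
Qed.

(** The eliminant is defined over any ring so that one formula serves for values in [K] and for
    polynomials in a chart parameter; evaluation links the two. *)
Lemma horner_eliminant (mu Y0 Y1 Y2 : {poly K}) t :
  (eliminant polyC mu Y0 Y1 Y2).[t] = eliminant id mu.[t] Y0.[t] Y1.[t] Y2.[t].
Proof.
have hX (a c e : K) :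
    (a%:P * Y0 + c%:P * Y1 + e%:P * Y2).[t] = a * Y0.[t] + c * Y1.[t] + e * Y2.[t].
  by rewrite !(hornerD, hornerM, hornerC).
rewrite /eliminant !(horner_exp, hornerD, hornerM) !hornerC horner_linf horner_quadf.
congr (_ + _ * _ ^+ 2 + _ ^+ 2).
  by apply: eq_bigr => i _; rewrite hX.
by apply: eq_bigr => i _; apply: eq_bigr => j _; rewrite !hX.
Qed.

(** The two inequalities bound the degree of [W] by [f]. The four terms then have degrees at most
    [2d + 3e], [2f], [f + 2e] and [4e], none exceeding [2f]. *)
Lemma deg_le_eliminant (mu Y0 Y1 Y2 : {poly K}) d e f :
  deg_le mu d -> deg_le Y0 e -> deg_le Y1 e -> deg_le Y2 e ->
  (2 * d + e <= f)%N -> (2 * e <= f)%N ->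
  deg_le (eliminant polyC mu Y0 Y1 Y2) (2 * f).
Proof.
move=> hm h0 h1 h2 hf hf'; rewrite /eliminant.
have hX i : deg_le ((n i o0 ^+ 2)%:P * Y0 + (n i o1 ^+ 2)%:P * Y1
                   + (n i o2 ^+ 2)%:P * Y2) e.
  by rewrite !deg_leD ?deg_leCM.
have hG : deg_le ((M o2 o0)%:P * Y0 + (M o2 o1)%:P * Y1 + (M o2 o2)%:P * Y2) e.
  by rewrite !deg_leD ?deg_leCM.
have hW : deg_le (mu ^+ 2 * Y2 +
    ((M o2 o0)%:P * Y0 + (M o2 o1)%:P * Y1 + (M o2 o2)%:P * Y2) ^+ 2) f.
  apply: deg_leD; first by apply: deg_leW hf _; rewrite deg_leM ?deg_leX.
  by apply: deg_leW hf' _; rewrite deg_leX.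
rewrite !deg_leD //.
- apply: (@deg_leW _ _ (2 * d + (e + e + e))); first by lia.
  exact: deg_leM (deg_leX _ hm) (deg_leM (deg_leM (hX _) (hX _)) (hX _)).
- by rewrite -polyC_exp deg_leCM // deg_leX.
- apply: (@deg_leW _ _ (f + 2 * e)); first by lia.
  by rewrite deg_leM // deg_leX // deg_le_linf // => i; exact: deg_leC.
- apply: (@deg_leW _ _ (2 * (2 * e))); first by lia.
  by rewrite deg_leX // deg_le_quadf // => i j; exact: deg_leC.
Qed.

End Reduced.

(** * Counting the solutions chart by chart *)

Section ReducedCount.
Variable K : closedFieldType.
Hypothesis charK : 2 \in [pchar K].
Variables (M n : 'M[K]_3) (lam : K) (q : 'I_3 -> K) (b : 'I_3 -> 'I_3 -> K).
Implicit Types (y : 'cV[K]_3) (z : K).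
Local Notation S := (reduced_sys M n lam q b).
Local Notation elim_poly := (eliminant M n lam q b polyC).

Lemma sqrt_existsb (a : K) : exists s, s ^+ 2 == a.
Proof. by have [s /eqP] := sqrt_exists a; exists s. Qed.

(** Square roots are unique in characteristic 2, so this choice inverts Frobenius. *)
Definition rt a := xchoose (sqrt_existsb a).

Lemma rtK a : rt a ^+ 2 = a.
Proof. exact/eqP/(xchooseP (sqrt_existsb a)). Qed.

Lemma rt_sq a : rt (a ^+ 2) = a.
Proof. by apply: (sqr2_inj charK); rewrite rtK. Qed.

Lemma col3_neq0 (a c e : K) : (a != 0) || (c != 0) || (e != 0) -> col3 a c e != 0.
Proof.
apply: contraTneq => /matrixP h; have := (h o0 0, h o1 0, h o2 0).
by rewrite !mxE /= => -[[-> ->] ->]; rewrite eqxx.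
Qed.

Hypothesis no_fam : no_family S.
Variables (T : finType) (y : T -> 'cV[K]_3) (z : T -> K).
Hypothesis hS : forall j, S (y j) (z j).
Hypothesis inj_yz : forall j k, y j = y k -> z j = z k -> j = k.

(** Along the curve [yp] the first two equations hold with multiplier [mp], and with no other since
    [y0] or [y1] is nonzero. Solutions are thus roots of the eliminant; if it vanished identically,
    every parameter would give one. A parameter determines [y] and [mu], hence [z^2] and [z]. *)
Lemma chart_card (A : {set T}) (f : T -> K) (yp : K -> 'cV[K]_3)
    (mp Y0 Y1 Y2 : {poly K}) d e g :
  deg_le mp d -> deg_le Y0 e -> deg_le Y1 e -> deg_le Y2 e ->
  (2 * d + e <= g)%N -> (2 * e <= g)%N ->
  (forall t, [/\ yp t o0 0 ^+ 2 = Y0.[t], yp t o1 0 ^+ 2 = Y1.[t]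
               & yp t o2 0 ^+ 2 = Y2.[t]]) ->
  (forall t, mp.[t] * yp t o0 0 = (M *m sq (yp t)) o0 0 /\
             mp.[t] * yp t o1 0 = (M *m sq (yp t)) o1 0) ->
  (forall t, (yp t o0 0 != 0) || (yp t o1 0 != 0)) ->
  (forall t t' c, c != 0 -> yp t' = c *: yp t -> t = t') ->
  {in A, forall j, y j = yp (f j)} ->
  (#|A| <= 2 * g)%N.
Proof.
move=> hd h0 h1 h2 hg hg' hY hmu y01 yinj hA.
have key t : (elim_poly mp Y0 Y1 Y2).[t] =
    eliminant M n lam q b id mp.[t] (yp t o0 0 ^+ 2) (yp t o1 0 ^+ 2) (yp t o2 0 ^+ 2).
  by have [-> -> ->] := hY t; rewrite horner_eliminant.
have mu_uniq t mu : mu * yp t o0 0 = (M *m sq (yp t)) o0 0 ->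
    mu * yp t o1 0 = (M *m sq (yp t)) o1 0 -> mu = mp.[t].
  have [<- <-] := hmu t.
  by case/orP: (y01 t) => /mulIf inj; [move/inj | move=> _ /inj].
apply: (@card_roots _ _ A f (elim_poly mp Y0 Y1 Y2)).
- apply/eqP => p0; apply: (no_fam (s := 1) (P := fun t x _ => x = yp t)).
  + exact: oner_neq0.
  + move=> t _; have [e0 e1] := hmu t.
    have yt0 : yp t != 0.
      by apply: contraTneq (y01 t) => ->; rewrite !mxE eqxx.
    have := @reduced_sys_exists _ charK M n lam q b mp.[t] (yp t) yt0 e0 e1.
    by rewrite -key p0 horner0 => /(_ erefl) [z0 hz0]; exists (yp t), z0.
  + by move=> t t' x x' _ _ c c0 -> -> /yinj h _; apply: h.
- exact: deg_le_eliminant hg hg'.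
- move=> j jA; have [mu [e0 e1 _ h]] := reduced_sysP charK (hS j).
  rewrite /root key; rewrite (hA j jA) in e0 e1 h.
  by rewrite -(mu_uniq _ _ e0 e1) h.
- move=> j k jA kA fjk; have yjk : y j = y k by rewrite !hA // fjk.
  apply: inj_yz => //; apply: (sqr2_inj charK).
  have [mu [e0 e1 -> _]] := reduced_sysP charK (hS j).
  have [mu' [e0' e1' -> _]] := reduced_sysP charK (hS k).
  rewrite -yjk in e0' e1' *; rewrite (hA j jA) in e0 e1 e0' e1'.
  by rewrite (mu_uniq _ _ e0 e1) (mu_uniq _ _ e0' e1').
Qed.

(** The point [k] is a chart of its own because the first two equations do not determine [mu]
    there. *)
Definition normalized y :=
  y o1 0 = 1 \/ y o1 0 = 0 /\ y o0 0 = 1 \/ y = col3 0 0 1.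

Hypothesis hnorm : forall j, normalized (y j).

(** The third column of [M] is [L k^(2)] in the new basis, which will be either the first basis
    vector or a multiple of the third; its middle entry vanishes in both cases. *)
Hypothesis M12 : M o1 o2 = 0.

Let A1 := [set j | y j o1 0 == 1].
Let A2 := [set j | (y j o1 0 == 0) && (y j o0 0 == 1)].
Let A3 := [set j | y j == col3 0 0 1].

Lemma card_charts : (#|T| <= #|A1| + #|A2| + #|A3|)%N.
Proof.
rewrite -cardsT; apply: leq_trans (_ : #|A1 :|: A2 :|: A3| <= _)%N.
  apply: subset_leq_card; apply/subsetP => j _; rewrite !inE.
  by case: (hnorm j) => [->|[[-> ->]|->]]; rewrite ?eqxx ?orbT.
apply: leq_trans (leq_card_setU _ _) _; rewrite leq_add2r; exact: leq_card_setU.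
Qed.

Lemma A2_M10 j : j \in A2 -> M o1 o0 = 0.
Proof.
rewrite inE => /andP [/eqP y1 /eqP y0].
have [mu [_]] := reduced_sysP charK (hS j).
rewrite mulmx_sqE y1 y0 M12 => + _ _.
by rewrite expr0n expr1n !(mulr0, mul0r, addr0, mulr1) => <-.
Qed.

(** If this chart has a point, the second equation holds on all of it, and the first gives
    [mu = M00 + M02 u] with parameter [u = y2^2]. Degree 1 in [mu] yields the bound [2 * 3], degree
    0 yields [2 * 2]. *)
Lemma card_A2 : (#|A2| <= 6)%N /\ (M o0 o2 = 0 -> (#|A2| <= 4)%N).
Proof.
have [->|[j0 /A2_M10 M10]] := set_0Vmem A2; first by rewrite cards0.
pose yp u := col3 1 0 (rt u) : 'cV[K]_3.
pose mp := (M o0 o0)%:P + (M o0 o2)%:P * 'X.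
have count d g : deg_le mp d -> (2 * d + 1 <= g)%N -> (2 <= g)%N -> (#|A2| <= 2 * g)%N.
  move=> hd hg hg'.
  apply: (@chart_card A2 (fun j => y j o2 0 ^+ 2) yp mp 1 0 'X d 1 g) => //.
  - by rewrite /deg_le size_poly1.
  - by rewrite /deg_le size_poly0.
  - by rewrite /deg_le size_polyX.
  - by move=> t; rewrite !mxE /= !hornerE rtK ?expr1n ?expr0n.
  - move=> t; rewrite !mulmx_sqE !mxE /= rtK M12 M10 !hornerE ?expr1n ?expr0n /=.
    by rewrite !(mulr0, mulr1, addr0, add0r, mul0r).
  - by move=> t; rewrite !mxE oner_neq0.
  - move=> t t' c _ /matrixP h; have := h o0 0; have := h o2 0; rewrite !mxE /= mulr1.
    by move=> + e; rewrite -e mul1r => e'; rewrite -[t]rtK -e' rtK.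
  - move=> j; rewrite inE => /andP [/eqP y1 /eqP y0]; rewrite [LHS]col3_eta y1 y0.
    by rewrite /yp rt_sq.
split.
  apply: (count 1 3) => //; rewrite /mp deg_leD ?deg_leC //.
  by rewrite deg_leCM // /deg_le size_polyX.
by move=> M02; apply: (count 0 2) => //; rewrite /mp M02 mul0r addr0 deg_leC.
Qed.

(* The eliminant has degree 14 in the chart [y1 = 1]; the line [y1 = 0] only
   carries points if [M o1 o0 = 0], and then 14 drops to 8 while that line
   contributes at most 6. *)
Lemma reduced_card_generic : M o0 o2 = 1 -> (#|T| <= 14)%N.
Proof.
move=> M02.
(* At [k] the first equation would read [0 = M02 = 1]. *)
have A3_0 : A3 = set0.
  apply/setP => j; rewrite !inE; apply/negP => /eqP yj.
  have [mu [+ _ _ _]] := reduced_sysP charK (hS j).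
  rewrite mulmx_sqE yj !mxE /= M02 expr0n expr1n !(mulr0, add0r, mulr1).
  by move/eqP; rewrite eq_sym oner_eq0.
(* With [y1 = 1] and [y0 = t], the second equation gives [mu], and the first then gives [y2^2],
   whose coefficient [M02] is 1. *)
pose mp := (M o1 o0)%:P * 'X^2 + (M o1 o1)%:P.
pose Sp := 'X * mp + ((M o0 o0)%:P * 'X^2 + (M o0 o1)%:P).
pose yp t := col3 t 1 (rt Sp.[t]) : 'cV[K]_3.
have mpE t : mp.[t] = M o1 o0 * t ^+ 2 + M o1 o1.
  by rewrite /mp !(hornerXn, hornerC, hornerD, hornerM).
have SpE t : Sp.[t] = t * mp.[t] + (M o0 o0 * t ^+ 2 + M o0 o1).
  rewrite /Sp hornerD hornerM hornerX; congr (_ + _).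
  by rewrite !(hornerXn, hornerC, hornerD, hornerM).
have X2 : deg_le ('X^2 : {poly K}) 2 by rewrite /deg_le size_polyXn.
have X1 : deg_le ('X : {poly K}) 1 by rewrite /deg_le size_polyX.
have count d e g : deg_le mp d -> deg_le Sp e -> (2 <= e)%N ->
    (2 * d + e <= g)%N -> (2 * e <= g)%N -> (#|A1| <= 2 * g)%N.
  move=> hd he e2 hg hg'.
  apply: (@chart_card A1 (fun j => y j o0 0) yp mp 'X^2 1 Sp d e g) => //.
  - exact: deg_leW e2 _.
  - by rewrite /deg_le size_poly1.
  - by move=> t; rewrite !mxE /= rtK !hornerE ?expr1n.
  - move=> t; rewrite !mulmx_sqE !mxE /= rtK M12 M02 mul0r mul1r addr0 expr1n !mulr1.
    by rewrite SpE addrCA (add2 charK) addr0 mulrC -mpE.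
  - by move=> t; rewrite !mxE oner_neq0 orbT.
  - move=> t t' c _ /matrixP h; have := h o0 0; have := h o1 0; rewrite !mxE /= mulr1.
    by move=> <- ->; rewrite mul1r.
  - move=> j; rewrite inE => /eqP y1.
    have [mu [e0 e1 _ _]] := reduced_sysP charK (hS j).
    rewrite [LHS]col3_eta y1 /yp; congr col3; apply: (sqr2_inj charK); rewrite rtK.
    move: e0 e1; rewrite !mulmx_sqE y1 M12 M02 mul0r mul1r addr0 expr1n !mulr1.
    move=> e0 e1; rewrite SpE mpE -e1 mulrC e0.
    by rewrite addrAC (add2 charK) add0r.
have dmp : deg_le mp 2 by rewrite /mp deg_leD ?deg_leC ?deg_leCM.
have dSp : deg_le Sp 3.
  rewrite /Sp deg_leD //; first exact: (deg_leM X1 dmp).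
  by apply: (@deg_leW _ _ 2) => //; rewrite deg_leD ?deg_leC ?deg_leCM.
apply: leq_trans card_charts _; rewrite A3_0 cards0 addn0.
(* The degrees of [mu] and [y2^2] are at most 0 and 2 in the first case, where [g = 4], and at most
   2 and 3 in the second, where [g = 7 = 2 * 2 + 3]. *)
have [M10|M10] := eqVneq (M o1 o0) 0.
  have dmp0 : deg_le mp 0 by rewrite /mp M10 mul0r add0r deg_leC.
  rewrite (leq_add (_ : _ <= 8)%N (card_A2.1)) //.
  apply: (count 0 2 4) => //; rewrite /Sp deg_leD //.
    by apply: (@deg_leW _ _ (1 + 0)) => //; rewrite deg_leM.
  by rewrite deg_leD ?deg_leC ?deg_leCM.
have -> : A2 = set0.
  by apply/setP => j; rewrite [RHS]inE; apply/negP => /A2_M10 /eqP; rewrite (negPf M10).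
by rewrite cards0 addn0; apply: (count 2 3 7).
Qed.


(** Over [k] the multiplier is [z^2 + M22], so the equation is a polynomial of degree at most 2 in
    [z^2]; if it vanished identically, every [z] would give a solution. *)
Lemma card_A3 : M o0 o2 = 0 -> (#|A3| <= 2)%N.
Proof.
move=> M02.
pose x := n *m col3 0 0 1.
pose l := linf q ((sq x)^~ 0); pose e := quadf b ((sq x)^~ 0).
pose p := ('X + (M o2 o2)%:P) * (prodc x)%:P + (lam%:P * 'X^2 + 'X * l%:P + e%:P).
have pE t : p.[t] = (t + M o2 o2) * prodc x + evenpart lam q b x t.
  by rewrite !(hornerXn, hornerX, hornerC, hornerD, hornerM).
have sq1 i : (M *m sq (col3 0 0 1)) i 0 = M i o2.
  by rewrite mulmx_sqE !mxE /= expr0n expr1n !mulr0 !add0r mulr1.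
apply: (@card_roots _ _ A3 (fun j => z j ^+ 2) p).
- apply/eqP => p0; apply: (no_fam (s := 1) (P := fun t x z => x = col3 0 0 1 /\ z = rt t)).
  + exact: oner_neq0.
  + move=> t _; exists (col3 0 0 1), (rt t); split=> //; split.
      by rewrite col3_neq0 // oner_neq0 orbT.
    exists (t + M o2 o2); split; last by rewrite rtK -pE p0 horner0.
    apply: cV3P; rewrite mxE sq1 !mxE /= ?M12 ?M02 ?mulr0 ?addr0 // rtK !mulr1 addrC.
    by [].
  + move=> t t' x1 x2 z1 z2 c _ [-> ->] [-> ->] /matrixP /(_ o2 0).
    by rewrite !mxE /= mulr1 => <-; rewrite mul1r => h; rewrite -[t]rtK -h rtK.
- rewrite /p; apply: leq_trans (size_polyD _ _) _; rewrite geq_max; apply/andP; split.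
    apply: (@deg_leW _ _ (1 + 0)) => //; rewrite deg_leM ?deg_leC // deg_leD ?deg_leC //.
    by rewrite /deg_le size_polyX.
  apply: deg_leD; last exact: deg_leC.
  apply: deg_leD; first by rewrite deg_leCM // /deg_le size_polyXn.
  by apply: (@deg_leW _ _ (1 + 0)) => //; rewrite deg_leM ?deg_leC // /deg_le size_polyX.
- move=> j; rewrite inE => /eqP yj; have [_ [mu [/matrixP /(_ o2 0)]]] := hS j.
  rewrite yj mxE sq1 !mxE /= !mulr1 => <-.
  by rewrite /root pE addrC [_ + M o2 o2]addrC addrC => ->.
- move=> j k; rewrite !inE => /eqP yj /eqP yk /(sqr2_inj charK) zjk.
  by apply: inj_yz => //; rewrite yj yk.
Qed.

(** The first hypothesis makes [t] a root of the cubic obtained by eliminating [mu] from the first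
    two equations. Both then hold along the line [y0 = t y1] with constant [mu] when [y1 = 1], and
    the eliminant has degree at most 4 in [y2^2]. *)
Lemma card_A1_fiber t :
  t * (M o1 o0 * t ^+ 2 + M o1 o1) + (M o0 o0 * t ^+ 2 + M o0 o1) = 0 -> M o0 o2 = 0 ->
  (#|[set j in A1 | y j o0 0%R == t]| <= 4)%N.
Proof.
move=> ct M02; pose yp u := col3 t 1 (rt u) : 'cV[K]_3.
apply: (@chart_card _ (fun j => y j o2 0 ^+ 2) yp (M o1 o0 * t ^+ 2 + M o1 o1)%:P
          (t ^+ 2)%:P 1 'X 0 1 2); rewrite ?deg_leC //.
- by rewrite /deg_le size_polyX.
- by move=> u; rewrite !mxE /= !hornerE rtK ?expr1n.
- move=> u; rewrite !mulmx_sqE !mxE /= rtK M12 M02 mul0r addr0 expr1n !mulr1.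
  by rewrite hornerC addr0; split=> //; apply/(eq_add2 charK); rewrite mulrC.
- by move=> u; rewrite !mxE oner_neq0 orbT.
- move=> u u' c _ /matrixP h; have := h o1 0; have := h o2 0; rewrite !mxE /= mulr1.
  by move=> + e; rewrite -e mul1r => e'; rewrite -[u]rtK -e' rtK.
- move=> j; rewrite !inE => /andP [/eqP y1 /eqP y0]; rewrite [LHS]col3_eta y1 y0.
  by rewrite /yp rt_sq.
Qed.

(** * Families of solutions over a conic *)

Section Conic.

Definition is_quad (f : K -> K -> K -> K) :=
  exists m0 m1 m2 m01 m02 m12, forall a c e, f a c e =
    m0 * a ^+ 2 + m1 * c ^+ 2 + m2 * e ^+ 2 + m01 * (a * c) + m02 * (a * e) + m12 * (c * e).

Definition is_lin (f : K -> K -> K -> K) :=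
  exists m0 m1 m2, forall a c e, f a c e = m0 * a + m1 * c + m2 * e.

Lemma is_quadM f g : is_lin f -> is_lin g -> is_quad (fun a c e => f a c e * g a c e).
Proof.
move=> [m0 [m1 [m2 hf]]] [p0 [p1 [p2 hg]]].
exists (m0 * p0), (m1 * p1), (m2 * p2), (m0 * p1 + m1 * p0), (m0 * p2 + m2 * p0).
exists (m1 * p2 + m2 * p1) => a c e; rewrite hf hg; ring.
Qed.

Lemma is_quadD f g : is_quad f -> is_quad g -> is_quad (fun a c e => f a c e + g a c e).
Proof.
move=> [m0 [m1 [m2 [m3 [m4 [m5 hf]]]]]] [p0 [p1 [p2 [p3 [p4 [p5 hg]]]]]].
exists (m0 + p0), (m1 + p1), (m2 + p2), (m3 + p3), (m4 + p4), (m5 + p5) => a c e.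
rewrite hf hg; ring.
Qed.

Lemma is_linf p (X : 'I_3 -> K -> K -> K -> K) :
  (forall i, is_lin (X i)) -> is_lin (fun a c e => linf p (fun i => X i a c e)).
Proof.
move=> h; have [m0 [m1 [m2 h0]]] := h o0; have [p0 [p1 [p2 h1]]] := h o1.
have [r0 [r1 [r2 h2]]] := h o2.
exists (p o0 * m0 + p o1 * p0 + p o2 * r0), (p o0 * m1 + p o1 * p1 + p o2 * r1).
exists (p o0 * m2 + p o1 * p2 + p o2 * r2) => a c e.
rewrite /linf sum3 h0 h1 h2; ring.
Qed.

Lemma is_quad_ext f g : (forall a c e, f a c e = g a c e) -> is_quad f -> is_quad g.
Proof.
move=> fg [m0 [m1 [m2 [m3 [m4 [m5 hf]]]]]].
by exists m0, m1, m2, m3, m4, m5 => a c e; rewrite -fg hf.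
Qed.

(** A conic over an algebraically closed field has infinitely many points; the cases below
    parametrise some of them so that the projective point determines the parameter. *)
Lemma conic_no_family (psi : K -> K -> K -> K) : is_quad psi ->
  (forall a c e, (a != 0) || (c != 0) || (e != 0) -> psi a c e = 0 ->
     exists z, S (col3 (rt a) (rt c) (rt e)) z) -> False.
Proof.
move=> [m0 [m1 [m2 [m01 [m02 [m12 psiE]]]]]] hpsi.
have fam1 (s : {poly K}) : s != 0 ->
    (forall t, ~~ root s t -> exists u, psi (t ^+ 2) 1 u = 0) -> False.
  move=> s0 hs; apply: (no_fam (P := fun t x _ => x o0 0 = t /\ x o1 0 = 1) s0).
    move=> t /hs [u hu]; have [|w hw] := hpsi _ _ _ _ hu; first by rewrite oner_neq0 orbT.
    exists (col3 (rt (t ^+ 2)) (rt 1) (rt u)), w; split=> //.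
    by rewrite !mxE /= rt_sq -{1}[1](expr1n _ 2) rt_sq.
  move=> t t' x x' _ _ c _ [<- x1] [<- x'1] e _; move: x'1; rewrite e !mxE x1 mulr1 => ->.
  by rewrite mul1r.
(* If [m2] is nonzero, a quadratic equation in the third variable is solvable for each [t]. *)
have [m2z|m2n] := eqVneq m2 0; last first.
  apply: (fam1 1); [exact: oner_neq0 | move=> t _].
  have [|u hu] := @quadratic_root _ m2 (m02 * t ^+ 2 + m12)
    (m0 * (t ^+ 2) ^+ 2 + m1 + m01 * t ^+ 2); first by rewrite m2n.
  exists u; rewrite psiE -[RHS]hu; ring.
(* The conic is now linear in the third variable and can be solved wherever the coefficient of that
   variable is nonzero. *)
have [sz|sn] := eqVneq (m02 *: 'X^2 + m12%:P) 0; last first.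
  apply: (fam1 _ sn) => t; rewrite /root !(hornerXn, hornerC, hornerD, hornerZ) => st.
  pose d := m02 * t ^+ 2 + m12; pose num := m0 * (t ^+ 2) ^+ 2 + m1 + m01 * t ^+ 2.
  exists (- num / d); rewrite psiE m2z.
  have : num + d * (- num / d) = 0 by rewrite mulrC divfK ?subrr.
  by move: (- num / d) => u e; rewrite -[RHS]e /num /d; ring.
have m02z : m02 = 0.
  have := congr1 (fun p : {poly K} => p`_2) sz.
  by rewrite /= coef0 coefD coefZ coefXn coefC mulr1 addr0.
have m12z : m12 = 0.
  have := congr1 (fun p : {poly K} => p`_0) sz.
  by rewrite /= coef0 coefD coefZ coefXn coefC mulr0 add0r.
(* Only a binary form in the first two variables remains; over one of its zeros the third coordinate
   is free. *)
have [a [c [ac hac]]] : exists a c,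
    (a != 0) || (c != 0) /\ m0 * a ^+ 2 + m1 * c ^+ 2 + m01 * (a * c) = 0.
  have [m0z|m0n] := eqVneq m0 0.
    by exists 1, 0; rewrite oner_neq0 m0z; split=> //; ring.
  have [|u hu] := @quadratic_root _ m0 m01 m1; first by rewrite m0n.
  exists u, 1; rewrite oner_neq0 orbT; split=> //.
  rewrite -[RHS]hu; ring.
apply: (no_fam (s := 1) (P := fun t x _ => x = col3 (rt a) (rt c) t)).
- exact: oner_neq0.
- move=> t _; have [||w hw] := hpsi a c (t ^+ 2); first by rewrite ac.
    rewrite psiE m2z m02z m12z -[RHS]hac; ring.
  by exists (col3 (rt a) (rt c) t), w; rewrite rt_sq in hw.
have rt0 r : r != 0 -> rt r != 0 by apply: contraNneq => h; rewrite -[r]rtK h expr0n.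
move=> t t' x x' _ _ d _ -> -> /matrixP h _; have := h o2 0; rewrite !mxE /= => ->.
have : d = 1.
  case/orP: ac => /rt0 rn; [have := h o0 0 | have := h o1 0]; rewrite !mxE /=.
    by rewrite -{1}[rt a]mul1r => /(mulIf rn).
  by rewrite -{1}[rt c]mul1r => /(mulIf rn).
by move=> ->; rewrite mul1r.
Qed.

End Conic.

(* At most three lines through [(0 : 0 : 1)], the roots of a binary cubic, with
   four points each, and two more points over [(0 : 0 : 1)]; if the cubic
   vanishes, the singular points lie over a whole conic. *)
Lemma reduced_card_invariant : M o0 o2 = 0 -> (#|T| <= 14)%N.
Proof.
move=> M02.
(* Adding [t] times the second equation to the first, at [y0 = t] and [y1 = 1], eliminates [mu]. *)
pose cp := (M o1 o0)%:P * 'X^3 + (M o0 o0)%:P * 'X^2 + (M o1 o1)%:P * 'X + (M o0 o1)%:P.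
have cpE t : cp.[t] = t * (M o1 o0 * t ^+ 2 + M o1 o1) + (M o0 o0 * t ^+ 2 + M o0 o1).
  by rewrite /cp !(hornerXn, hornerX, hornerC, hornerD, hornerM); ring.
have [cp0|cpn] := eqVneq cp 0.
  have coef i := congr1 (fun p : {poly K} => p`_i) cp0.
  have M10 : M o1 o0 = 0.
    by have := coef 3; rewrite !(coefD, coefCM, coefXn, coefX, coefC, coef0) /=
      !(mulr0, mulr1, addr0, add0r).
  have M00 : M o0 o0 = 0.
    by have := coef 2; rewrite !(coefD, coefCM, coefXn, coefX, coefC, coef0) /=
      !(mulr0, mulr1, addr0, add0r).
  have M11 : M o1 o1 = 0.
    by have := coef 1; rewrite !(coefD, coefCM, coefXn, coefX, coefC, coef0) /=
      !(mulr0, mulr1, addr0, add0r).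
  have M01 : M o0 o1 = 0.
    by have := coef 0; rewrite !(coefD, coefCM, coefXn, coefX, coefC, coef0) /=
      !(mulr0, mulr1, addr0, add0r).
  exfalso.
  (* The first two rows of [M] vanish, so [mu = 0] satisfies the first two equations for every [y];
     what remains is the quadratic form [psi] in the squares of the coordinates. *)
  pose X i a c e := n i o0 ^+ 2 * a + n i o1 ^+ 2 * c + n i o2 ^+ 2 * e.
  pose G a c e := M o2 o0 * a + M o2 o1 * c + M o2 o2 * e.
  pose psi a c e := lam * G a c e * G a c e + G a c e * linf q (fun i => X i a c e)
    + quadf b (fun i => X i a c e).
  have XL i : is_lin (X i) by do 3 eexists; move=> *; reflexivity.
  have GL : is_lin G by do 3 eexists; move=> *; reflexivity.
  apply: (@conic_no_family psi).
    apply: is_quadD; first apply: is_quadD.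
    - apply: is_quadM => //; exists (lam * M o2 o0), (lam * M o2 o1), (lam * M o2 o2).
      by move=> a c e; rewrite /G; ring.
    - by apply: is_quadM => //; exact: is_linf.
    apply: (@is_quad_ext (fun a c e =>
        linf (b o0) (fun i => X i a c e) * X o0 a c e +
        linf (b o1) (fun i => X i a c e) * X o1 a c e +
        linf (b o2) (fun i => X i a c e) * X o2 a c e)).
      by move=> a c e; rewrite quadfE {4}/linf sum3.
    by apply: is_quadD; [apply: is_quadD|]; apply: is_quadM => //; exact: is_linf.
  move=> a c e hne h.
  have hy : col3 (rt a) (rt c) (rt e) != 0.
    by apply: col3_neq0; move: hne; rewrite -{1}[a]rtK -{1}[c]rtK -{1}[e]rtK !expf_eq0.
  apply: (@reduced_sys_exists _ charK M n lam q b 0 _ hy).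
  - by rewrite mulmx_sqE M00 M01 M02 !mul0r !addr0.
  - by rewrite mulmx_sqE M10 M11 M12 !mul0r !addr0.
  rewrite !mxE /= !rtK /eliminant expr0n /= !mul0r !add0r.
  rewrite -/(G a c e) -[RHS](expr0n K 2) -h /psi.
  have sqr2D3 (u v w : K) : (u + v + w) ^+ 2 = u ^+ 2 + v ^+ 2 + w ^+ 2.
    by rewrite !(sqr2D charK).
  rewrite [RHS]sqr2D3.
  transitivity (lam ^+ 2 * (G a c e ^+ 2) ^+ 2
    + G a c e ^+ 2 * linf q (fun i => X i a c e) ^+ 2 + quadf b (fun i => X i a c e) ^+ 2).
    by [].
  by ring.
have [rs hrs] := closed_field_poly_normal cp.
have dcp : deg_le cp 3.
  have X2 : deg_le ('X^2 : {poly K}) 3 by rewrite /deg_le size_polyXn.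
  have X1 : deg_le ('X : {poly K}) 3 by rewrite /deg_le size_polyX.
  by rewrite /cp !deg_leD ?deg_leCM ?deg_leC // /deg_le size_polyXn.
have srs : size cp = (size rs).+1.
  by rewrite hrs size_scale ?lead_coef_eq0 // size_prod_XsubC.
have A1_le : (#|A1| <= size rs * 4)%N.
  have inrs j : j \in A1 -> y j o0 0 \in rs.
    rewrite inE => /eqP y1; have [mu [e0 e1 _ _]] := reduced_sysP charK (hS j).
    have : root cp (y j o0 0).
      rewrite /root cpE; move: e0 e1; rewrite !mulmx_sqE y1 M12 M02 !mul0r !addr0.
      by rewrite expr1n !mulr1 => <- <-; rewrite mulrC (add2 charK).
    by rewrite hrs rootZ ?lead_coef_eq0 // root_prod_XsubC.
  apply: card_fibers inrs _ => u urs; apply: card_A1_fiber => //.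
  rewrite -cpE; apply/eqP; rewrite -/(root cp u) hrs rootZ ?lead_coef_eq0 //.
  by rewrite root_prod_XsubC.
apply: leq_trans card_charts _.
have A3_le := card_A3 M02; have [_ /(_ M02) A2_le] := card_A2.
(* The line [y1 = 0] is a zero of the homogenised cubic exactly when [M10 = 0]. The total is at most
   [2 * 4 + 4 + 2] in that case and [3 * 4 + 0 + 2] otherwise. *)
have [M10|M10] := eqVneq (M o1 o0) 0.
  have : deg_le cp 2.
    have X2 : deg_le ('X^2 : {poly K}) 2 by rewrite /deg_le size_polyXn.
    have X1 : deg_le ('X : {poly K}) 2 by rewrite /deg_le size_polyX.
    by rewrite /cp M10 mul0r add0r !deg_leD ?deg_leCM ?deg_leC.
  by rewrite /deg_le srs; lia.
have A20 : A2 = set0.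
  by apply/setP => j; rewrite [RHS]inE; apply/negP => /A2_M10 /eqP; rewrite (negPf M10).
by move: dcp; rewrite /deg_le srs A20 cards0; lia.
Qed.

End ReducedCount.

(** * The case of a square quadric *)

Section SquareQuadric.
Variable K : closedFieldType.
Hypothesis charK : 2 \in [pchar K].

(* The rows of [X] solve [x = x^(2) A]; in a basis of rows of [X] their
   coordinates are fixed by Frobenius, hence lie in [F_2]. *)
Lemma frobenius_fixed_rows N (X : 'M[K]_(N, 3)) (A : 'M[K]_3) : X = sq X *m A ->
  exists (U : finType) (phi : 'I_N -> U),
    (#|U| <= 8)%N /\ forall i j, phi i = phi j -> row i X = row j X.
Proof.
move=> XA; pose R := rowsub (maxrankfun X) X.
have Rfree : row_free R := maxrowsub_free X.
have [C XC] : exists C, X = C *m R.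
  by exists (X *m pinvmx R); rewrite mulmxKpV // eq_maxrowsub.
have RA : R = sq R *m A.
  apply/matrixP => i j; have /matrixP/(_ (maxrankfun X i) j) := XA.
  by rewrite !mxE => ->; apply: eq_bigr => k _; rewrite !mxE.
have Csq : C = sq C.
  by apply: (row_free_inj Rfree); rewrite -XC {1}XA {1}XC sqM // -mulmxA -RA.
have C01 i j : C i j = (C i j != 0)%:R.
  have /matrixP/(_ i j) := Csq; rewrite mxE => /esym/eqP.
  rewrite expr2 -[X in _ == X]mulr1 -subr_eq0 -mulrBr mulf_eq0 subr_eq0.
  by case/orP => /eqP ->; rewrite ?eqxx ?oner_neq0.
exists {ffun 'I_(\rank X) -> bool}, (fun i => [ffun k => C i k != 0]); split.
  by rewrite card_ffun card_bool card_ord (@leq_pexp2l 2 _ 3) // rank_leq_col.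
move=> i j /ffunP h; apply/rowP => a; rewrite !mxE XC !mxE; apply: eq_bigr => k _.
by rewrite C01 [C j k]C01; have := h k; rewrite !ffunE => ->.
Qed.

Variables (L : 'M[K]_3) (lam : K) (q : 'I_3 -> K) (b : 'I_3 -> 'I_3 -> K).
Local Notation S := (sing_sys L 0 lam q b).
Hypothesis no_fam : no_family S.

Let ell (x : 'cV[K]_3) := linf q ((sq x)^~ 0).
Let bb (x : 'cV[K]_3) := quadf b ((sq x)^~ 0).

Lemma sing_sys0P x z : S x z <-> x != 0 /\ exists mu, L *m sq x = mu *: x /\
  lam * (z ^+ 2) ^+ 2 + ell x * z ^+ 2 + (bb x + mu * prodc x) = 0.
Proof.
have e mu : mu * prodc x + evenpart lam q b x (z ^+ 2) =
    lam * (z ^+ 2) ^+ 2 + ell x * z ^+ 2 + (bb x + mu * prodc x).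
  by rewrite /evenpart /ell /bb addrC [z ^+ 2 * _]mulrC !addrA.
rewrite /sing_sys; split=> -[x0 [mu [h1 h2]]]; split=> //; exists mu; move: h1 h2.
  by rewrite scaler0 addr0 e.
by rewrite scaler0 addr0 e.
Qed.

(** Under these equations the quadratic in [z^2] over [x] vanishes identically, so every [z] gives a
    singular point over [x]. *)
Lemma sing_sys0_nondeg x mu : x != 0 -> L *m sq x = mu *: x ->
  lam = 0 -> ell x = 0 -> bb x + mu * prodc x = 0 -> False.
Proof.
move=> x0 Lx l0 lx bx; apply: (no_fam (s := 1) (P := fun t v w => v = x /\ w = t)).
- exact: oner_neq0.
- move=> t _; exists x, t; split=> //; apply/sing_sys0P; split=> //; exists mu; split=> //.
  by rewrite l0 lx bx !mul0r !addr0.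
- move=> t t' v v' w w' c _ [-> ->] [-> ->] h ->.
  have [i xi] := cV3_neq0 x0; move/matrixP/(_ i 0): h; rewrite mxE.
  by rewrite -{1}[x i 0]mul1r => /(mulIf xi) <-; rewrite mul1r.
Qed.

(** The zeros of [L x^(2)] form a subspace. If [x] and [x'] were independent in it, every [x + t x']
    would satisfy the gradient equations with [mu = 0], and the equation in [z^2] would be solvable
    for all but finitely many [t]. *)
Lemma kernel_colinear x x' z : S x z -> L *m sq x = 0 -> x' != 0 -> L *m sq x' = 0 ->
  exists c, x' = c *: x.
Proof.
move=> /sing_sys0P [x0 [mu [Lx h]]] kx x'0 kx'.
have mu0 : mu = 0.
  by move/eqP: Lx; rewrite kx eq_sym scaler_eq0 (negPf x0) orbF => /eqP.
have [i xi] := cV3_neq0 x0.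
have [<-|nc] := eqVneq (x' i 0 / x i 0 *: x) x'; first by exists (x' i 0 / x i 0).
have ncol c : x' <> c *: x.
  by move=> e; move: nc; rewrite e mxE mulfK ?eqxx.
exfalso.
have v0 t : x + t *: x' != 0.
  apply/eqP => e; have [tz|tn] := eqVneq t 0.
    by move: e; rewrite tz scale0r addr0 => /eqP; rewrite (negPf x0).
  apply: (ncol (- t^-1)); apply: (scalerI tn); rewrite scalerA mulrN divff // scaleN1r.
  by apply/eqP; rewrite -addr_eq0 addrC e.
have ellD t : ell (x + t *: x') = ell x + t ^+ 2 * ell x'.
  rewrite /ell /linf !sum3 !mxE; rewrite !(sqr2D charK) !exprMn; ring.
have Lv t : L *m sq (x + t *: x') = 0 *: (x + t *: x').
  by rewrite sqD // sqZ mulmxDr kx -scalemxAr kx' scaler0 addr0 scale0r.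
(* At a non-root [t] of [s], [lam] or [ell (x + t x')] is nonzero, so the equation in [z^2] is not
   constant. The distinct exponents ensure that [s = 0] forces [lam = 0] and [ell x = 0], which
   [sing_sys0_nondeg] excludes. *)
apply: (no_fam (s := (ell x' *: 'X^2 + (ell x)%:P) + lam%:P * 'X^3)
         (P := fun t v _ => v = x + t *: x')).
- apply/eqP => s0.
  have coef k := congr1 (fun p : {poly K} => p`_k) s0.
  have l0 : lam = 0.
    by have := coef 3; rewrite !(coefD, coefZ, coefCM, coefXn, coefC, coef0) /=
      !(mulr0, mulr1, addr0, add0r).
  have lx : ell x = 0.
    by have := coef 0; rewrite !(coefD, coefZ, coefCM, coefXn, coefC, coef0) /=
      !(mulr0, mulr1, addr0, add0r).
  apply: (sing_sys0_nondeg x0 Lx l0 lx); move: h.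
  by rewrite l0 lx !mul0r !add0r.
- move=> t; rewrite /root !(hornerXn, hornerX, hornerC, hornerD, hornerZ, hornerM) => st.
  have ne : (lam != 0) || (ell (x + t *: x') != 0).
    apply: contraNT st; rewrite negb_or !negbK => /andP [/eqP -> /eqP].
    by rewrite ellD mul0r addr0 addrC mulrC => ->.
  have [u hu] := quadratic_root (bb (x + t *: x') + 0 * prodc (x + t *: x')) ne.
  have [w hw] := sqrt_exists u; exists (x + t *: x'), w; split=> //.
  by apply/sing_sys0P; split=> //; exists 0; rewrite hw.
- move=> t t' v v' _ _ c _ -> -> e _.
  have e' : (c * t - t') *: x' = (1 - c) *: x.
    rewrite !scalerBl scale1r -scalerA.
    apply/eqP; rewrite subr_eq -addrA [_ + t' *: x']addrC addrA e scalerDr.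
    by rewrite [c *: x + _]addrC addrK.
  have ct : c * t = t'.
    apply/eqP; rewrite -subr_eq0; apply/negP => /negP n0.
    apply: (ncol ((c * t - t')^-1 * (1 - c))).
    by rewrite -scalerA -e' scalerA mulVf // scale1r.
  move/eqP: e'; rewrite ct subrr scale0r eq_sym scaler_eq0 (negPf x0) orbF subr_eq0.
  by move=> /eqP c1; rewrite -ct -c1 mul1r.
Qed.

Variables (T : finType) (x : T -> 'cV[K]_3) (z : T -> K).
Hypothesis hS : forall j, S (x j) (z j).
Hypothesis inj_xz : forall j k c, c != 0 -> x k = c *: x j -> z k = c * z j -> j = k.

(** This bounds the number of values of [z^2] over one point [x]; it drops when [lam = 0], the only
    case in which the apex can be singular. *)
Let e := if lam == 0 then 1%N else 2%N.

Lemma colinear_card (A : {set T}) j0 : (forall k, k \in A -> exists c, x k = c *: x j0) ->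
  (#|A| <= e)%N.
Proof.
move=> hA; have /sing_sys0P [x0 [mu [Lx _]]] := hS j0.
have [i xi] := cV3_neq0 x0.
pose c k := x k i 0 / x j0 i 0.
have xk k : k \in A -> x k = c k *: x j0.
  by move=> /hA [a ea]; rewrite /c {2}ea mxE mulfK.
have cn k : k \in A -> c k != 0.
  move=> /xk ek; apply/eqP => c0; have [] := hS k.
  by rewrite ek c0 scale0r eqxx.
pose p := lam%:P * 'X^2 + ((ell (x j0))%:P * 'X + (bb (x j0) + mu * prodc (x j0))%:P).
have pE t : p.[t] = lam * t ^+ 2 + ell (x j0) * t + (bb (x j0) + mu * prodc (x j0)).
  by rewrite /p !(hornerXn, hornerX, hornerC, hornerD, hornerM) addrA.
apply: (@card_roots _ _ A (fun k => (z k / c k) ^+ 2) p).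
- apply/eqP => p0; have coef k := congr1 (fun p : {poly K} => p`_k) p0.
  apply: (sing_sys0_nondeg x0 Lx).
  + by have := coef 2; rewrite !(coefD, coefCM, coefXn, coefX, coefC, coef0) /=
      !(mulr0, mulr1, addr0, add0r).
  + by have := coef 1; rewrite !(coefD, coefCM, coefXn, coefX, coefC, coef0) /=
      !(mulr0, mulr1, addr0, add0r).
  + by have := coef 0; rewrite !(coefD, coefCM, coefXn, coefX, coefC, coef0) /=
      !(mulr0, mulr1, addr0, add0r).
- have X1 d : (0 < d)%N -> deg_le ('X : {poly K}) d by move=> d0; rewrite /deg_le size_polyX.
  rewrite /p /e; have [->|_] := eqVneq lam 0.
    by rewrite mul0r add0r; rewrite -/(deg_le _ _) deg_leD ?deg_leC ?deg_leCM ?X1.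
  by rewrite -/(deg_le _ _) !deg_leD ?deg_leC ?deg_leCM ?X1 // /deg_le size_polyXn.
- move=> k kA; have ci : (c k)^-1 != 0 by rewrite invr_eq0 cn.
  have := sing_sysZ ci (hS k); rewrite xk // scalerA mulVf ?cn // scale1r.
  move=> /sing_sys0P [_ [mu' [Lx' h]]]; rewrite /root pE mulrC.
  suff -> : mu = mu' by rewrite mulrC [z k / _]mulrC h.
  apply/eqP; rewrite -subr_eq0; have /eqP := Lx; rewrite Lx' -subr_eq0 -scalerBl.
  by rewrite scaler_eq0 (negPf x0) orbF -opprB oppr_eq0.
- move=> k k' kA k'A /(sqr2_inj charK) zz; apply: (@inj_xz _ _ (c k' / c k)).
  + by rewrite mulf_neq0 ?invr_eq0 ?cn.
  + by rewrite (xk k) // scalerA divfK ?cn // -xk.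
  + have -> : z k' = c k' * (z k / c k) by rewrite zz mulrC divfK ?cn.
    by rewrite mulrA mulrAC.
Qed.

Lemma square_quadric_card : (#|T| <= 8 * e)%N.
Proof.
have /fin_all_exists [mu hmu] : forall j, exists mu, L *m sq (x j) = mu *: x j.
  by move=> j; have /sing_sys0P [_ [mu [h _]]] := hS j; exists mu.
have x0 j : x j != 0 by have [] := hS j.
(* Dividing by [mu] turns [L x^(2) = mu x] into a fixed-point equation. For [mu = 0] the convention
   [0^-1 = 0] produces a zero row, which also satisfies it. *)
pose X := \matrix_(i < #|T|) ((mu (enum_val i))^-1 *: x (enum_val i))^T.
have XE i : row i X = ((mu (enum_val i))^-1 *: x (enum_val i))^T by rewrite rowK.
have [U [phi [U8 hphi]]] : exists (U : finType) (phi : 'I_#|T| -> U),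
    (#|U| <= 8)%N /\ forall i j, phi i = phi j -> row i X = row j X.
  apply: (@frobenius_fixed_rows _ X L^T); apply/row_matrixP => i.
  rewrite row_mul; have -> : row i (sq X) = sq (row i X) by apply/rowP => a; rewrite !mxE.
  rewrite XE; have -> (v : 'cV[K]_3) : sq v^T = (sq v)^T by apply/matrixP => a c; rewrite !mxE.
  rewrite -trmx_mul sqZ -scalemxAr hmu scalerA; congr (_ *: _)^T.
  set m := mu _; have [->|mn] := eqVneq m 0; first by rewrite invr0 expr0n mul0r.
  by rewrite expr2 mulfVK.
have hx j k : phi (enum_rank j) = phi (enum_rank k) -> (mu j)^-1 *: x j = (mu k)^-1 *: x k.
  by move=> /hphi; rewrite !XE !enum_rankK => /trmx_inj.
rewrite -cardsT; apply: leq_trans (leq_mul U8 (leqnn e)); rewrite [#|U|]cardE.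
apply: (@card_fibers _ _ [set: T] (fun j => phi (enum_rank j)) (enum U)).
  by move=> j _; rewrite mem_enum.
move=> u _; set A := [set _ in _ | _]; have [->|[j0]] := set_0Vmem A; first by rewrite cards0.
rewrite !inE /= => /eqP j0u; apply: (@colinear_card _ j0) => k.
rewrite !inE /= => /eqP ku; have := hx k j0; rewrite ku j0u => /(_ erefl) ekj.
(* The zero row gathers all points with [mu = 0], whose vectors are proportional by
   [kernel_colinear]. *)
have [k0|kn] := eqVneq (mu k) 0.
  have j00 : mu j0 = 0.
    move/eqP: ekj; rewrite k0 invr0 scale0r eq_sym scaler_eq0 (negPf (x0 _)) orbF.
    by rewrite invr_eq0 => /eqP.
  apply: (kernel_colinear (hS j0)) => //; first by rewrite hmu j00 scale0r.
  by rewrite hmu k0 scale0r.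
by exists (mu k * (mu j0)^-1); rewrite -scalerA -ekj scalerA mulfV ?scale1r.
Qed.
End SquareQuadric.

(** * Reduction of the general case to the eliminant *)

Section NonsquareQuadric.
Variable K : closedFieldType.
Hypothesis charK : 2 \in [pchar K].

(** Some minor of [h] and [k], in rows [i] and [j], is nonzero; the standard vector at the remaining
    index completes the basis. *)
Lemma basis_exists (h k : 'cV[K]_3) : k != 0 -> (forall c, h <> c *: k) ->
  exists g : 'M[K]_3, [/\ g \in unitmx, g *m col3 1 0 0 = h & g *m col3 0 0 1 = k].
Proof.
move=> k0 nhk.
have [i [j hij]] : exists i j, h i 0 * k j 0 != h j 0 * k i 0.
  have [/existsP [i /existsP [j ij]]|] :=
    boolP [exists i, exists j, h i 0 * k j 0 != h j 0 * k i 0]; first by exists i, j.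
  rewrite negb_exists => /forallP hh; exfalso.
  have [c hc] : exists c, h = c *: k; last exact: nhk hc.
  apply: colinear => // i j; apply/eqP; have := hh i; rewrite negb_exists => /forallP /(_ j).
  by rewrite negbK.
have [a [ai aj]] : exists a : 'I_3, a != i /\ a != j.
  move: hij; elim/ord3P: i; elim/ord3P: j; rewrite ?eqxx // => _;
  by [exists o0 | exists o1 | exists o2].
pose e : 'cV[K]_3 := delta_mx a 0.
pose g : 'M[K]_3 := \matrix_(r, s) nth 0 [:: h r 0; e r 0; k r 0] s.
exists g; split.
- rewrite -unitmx_tr -row_free_unit; apply/inj_row_free => v vg.
  have eqr r : v 0 o0 * h r 0 + v 0 o1 * e r 0 + v 0 o2 * k r 0 = 0.
    by have /rowP/(_ r) := vg; rewrite !mxE sum3 !mxE.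
  have en r : a != r -> e r 0 = 0 by rewrite mxE eq_sym => /negPf ->.
  have := eqr i; have := eqr j; rewrite !en // mulr0 !addr0 => ej ei.
  have dn : h i 0 * k j 0 - h j 0 * k i 0 != 0 by rewrite subr_eq0.
  have v0 : v 0 o0 = 0.
    apply: (mulIf dn); rewrite mul0r.
    transitivity ((v 0 o0 * h i 0 + v 0 o2 * k i 0) * k j 0
       - (v 0 o0 * h j 0 + v 0 o2 * k j 0) * k i 0); first by ring.
    by rewrite ei ej !mul0r subr0.
  have v2 : v 0 o2 = 0.
    apply: (mulIf dn); rewrite mul0r.
    transitivity ((v 0 o0 * h j 0 + v 0 o2 * k j 0) * h i 0
       - (v 0 o0 * h i 0 + v 0 o2 * k i 0) * h j 0); first by ring.
    by rewrite ei ej !mul0r subr0.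
  have v1 : v 0 o1 = 0.
    by have := eqr a; rewrite v0 v2 !mul0r add0r addr0 mxE !eqxx mulr1.
  by apply/rowP => s; rewrite mxE; elim/ord3P: s.
- by apply/matrixP => r s; rewrite ord1 mxE sum3 !mxE /= !mulr0 !addr0 mulr1.
- by apply/matrixP => r s; rewrite ord1 mxE sum3 !mxE /= !mulr0 !add0r mulr1.
Qed.

Lemma noncolinear_exists (k : 'cV[K]_3) : k != 0 -> exists h : 'cV[K]_3, forall c, h <> c *: k.
Proof.
move=> /cV3_neq0 [i ki].
have [j ji] : exists j : 'I_3, j != i.
  by elim/ord3P: i ki => _; by [exists o0 | exists o1].
exists (delta_mx j 0) => c /matrixP e; have := e i 0; rewrite !mxE eq_sym (negPf ji) /=.
move/esym/eqP; rewrite mulf_eq0 (negPf ki) orbF => /eqP c0.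
by have := e j 0; rewrite !mxE c0 mul0r !eqxx => /eqP; rewrite oner_eq0.
Qed.

Variables (L : 'M[K]_3) (k : 'cV[K]_3) (lam : K) (q : 'I_3 -> K) (b : 'I_3 -> 'I_3 -> K).
Local Notation S := (sing_sys L k lam q b).

(** Since [x = g *m y] squares to [sq g *m sq y], the matrix [L] is multiplied by the inverse of [g]
    on the left but by its Frobenius twist on the right. *)
Lemma reduced_sysE (g : 'M[K]_3) y z : g \in unitmx -> g *m col3 0 0 1 = k ->
  S (g *m y) z <-> reduced_sys (invmx g *m L *m sq g) g lam q b y z.
Proof.
move=> gu gk; have g0 : (g *m y != 0) = (y != 0).
  congr (~~ _); apply/eqP/eqP => [e|->]; last by rewrite mulmx0.
  by rewrite -(mulKmx gu y) e mulmx0.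
rewrite /sing_sys /reduced_sys g0.
have key mu : L *m sq (g *m y) + z ^+ 2 *: k = mu *: (g *m y) <->
    invmx g *m L *m sq g *m sq y + z ^+ 2 *: col3 0 0 1 = mu *: y.
  rewrite -gk scalemxAr [mu *: _]scalemxAr sqM //; split=> [e|<-].
    by rewrite -[RHS](mulKmx gu) -e mulmxDr mulKmx // !mulmxA.
  by rewrite mulmxDr !mulmxA mulmxV // mul1mx.
by split=> -[y0 [mu [e h]]]; split=> //; exists mu; split=> //; apply/key.
Qed.

Lemma normalize (y : 'cV[K]_3) : y != 0 -> exists c, c != 0 /\ normalized (c *: y).
Proof.
move=> y0; rewrite /normalized.
have [y1|y1] := eqVneq (y o1 0) 0; last first.
  by exists (y o1 0)^-1; rewrite invr_eq0; split=> //; left; rewrite mxE mulVf.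
have [y00|y00] := eqVneq (y o0 0) 0; last first.
  by exists (y o0 0)^-1; rewrite invr_eq0; split=> //; right; left; rewrite !mxE mulVf // y1 mulr0.
have y2 : y o2 0 != 0.
  by have [i] := cV3_neq0 y0; elim/ord3P: i => //; rewrite ?y1 ?y00 eqxx.
exists (y o2 0)^-1; rewrite invr_eq0; split=> //; right; right.
by apply: cV3P; rewrite !mxE /= ?y1 ?y00 ?mulr0 // mulVf.
Qed.

Hypothesis k0 : k != 0.
Hypothesis no_fam : no_family S.
Variables (T : finType) (x : T -> 'cV[K]_3) (z : T -> K).
Hypothesis hS : forall j, S (x j) (z j).
Hypothesis inj_xz : forall j k c, c != 0 -> x k = c *: x j -> z k = c * z j -> j = k.

Lemma nonsquare_quadric_card : (#|T| <= 14)%N.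
Proof.
(* In the new basis this vector is the third column of [M]; whether it is a multiple of [k]
   separates the two normal forms. *)
pose h := L *m sq k.
have [g [gu gk gh]] : exists g : 'M[K]_3, [/\ g \in unitmx, g *m col3 0 0 1 = k &
    (exists c, h = c *: k) \/ g *m col3 1 0 0 = h].
  have [i ki] := cV3_neq0 k0.
  have [e|ne] := eqVneq (h i 0 / k i 0 *: k) h.
    have [h' nh'] := noncolinear_exists k0.
    have [g [gu _ gk]] := basis_exists k0 nh'.
    by exists g; split=> //; left; exists (h i 0 / k i 0).
  have [|g [gu gh gk]] := @basis_exists h k k0.
    by move=> c e; move: ne; rewrite e mxE mulfK ?eqxx.
  by exists g; split=> //; right.
pose M := invmx g *m L *m sq g.
have no_fam' : no_family (reduced_sys M g lam q b).
  move=> s P s0 hP injP; apply: (no_fam (s := s) (P := fun t v w => P t (invmx g *m v) w)) => //.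
    move=> t /hP [v [w [/(reduced_sysE _ _ gu gk) hv p]]].
    by exists (g *m v), w; rewrite mulKmx.
  move=> t t' v v' w w' c cn p p' e1 e2; apply: injP cn p p' _ e2.
  by rewrite e1 scalemxAr.
have x0 j : invmx g *m x j != 0.
  have [xj _] := hS j; apply: contraNneq xj => e.
  by rewrite -(mulKVmx gu (x j)) e mulmx0.
have /fin_all_exists [c hc] j := normalize (x0 j).
pose y j := c j *: (invmx g *m x j); pose w j := c j * z j.
have cn j : c j != 0 by have [] := hc j.
have hy j : reduced_sys M g lam q b (y j) (w j).
  apply/(reduced_sysE _ _ gu gk); rewrite /y -scalemxAr mulKVmx //.
  exact: sing_sysZ.
have inj_yw j j' : y j = y j' -> w j = w j' -> j = j'.
  rewrite /y /w => e1 e2; apply: (@inj_xz _ _ ((c j')^-1 * c j)).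
  - by rewrite mulf_neq0 ?invr_eq0.
  - have := congr1 (mulmx g) e1; rewrite -!scalemxAr !mulKVmx // => e3.
    by rewrite -scalerA e3 scalerA mulVf ?scale1r.
  - by rewrite -mulrA e2 mulKf.
have hn j : normalized (y j) by have [] := hc j.
have Me : M *m col3 0 0 1 = invmx g *m h.
  have -> : col3 0 0 1 = sq (col3 0 0 1) :> 'cV[K]_3.
    by apply: cV3P; rewrite !mxE /= ?expr0n ?expr1n.
  by rewrite /M -mulmxA -sqM // gk -mulmxA.
clearbody M.
have Mi i : M i o2 = (invmx g *m h) i 0.
  by rewrite -Me mxE sum3 !mxE /= !mulr0 !add0r mulr1.
case: gh => [[a ha]|gh].
  have e : invmx g *m h = a *: col3 0 0 1 by rewrite ha -scalemxAr -gk mulKmx.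
  have M12 : M o1 o2 = 0 by rewrite Mi e !mxE /= mulr0.
  have M02 : M o0 o2 = 0 by rewrite Mi e !mxE /= mulr0.
  exact: (reduced_card_invariant charK no_fam' hy inj_yw hn M12 M02).
have e : invmx g *m h = col3 1 0 0 by rewrite -gh mulKmx.
have M12 : M o1 o2 = 0 by rewrite Mi e !mxE.
have M02 : M o0 o2 = 1 by rewrite Mi e !mxE.
exact: (reduced_card_generic charK no_fam' hy inj_yw hn M12 M02).
Qed.
End NonsquareQuadric.

(** * The bound *)

Theorem theorem2p6 (K : closedFieldType) (lam : K) (Q B : {mpoly K[3]}) :
  (2 \in [pchar K])%N ->
  Q \is 2.-homog -> B \is 4.-homog ->
  normal_hypersurface (quartic_F lam Q B) ->
  forall (N : nat) (f : 'I_N -> 'I_4 -> K),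
    (forall j, is_sing_pt (quartic_F lam Q B) (f j)) ->
    (forall j k, proj_eq (f j) (f k) -> j = k) ->
    (N <= 16)%N.
Proof.
move=> charK /(quadricP charK) [k [q hQ]] /(quarticP charK) [l [b hB]] [_ hfin] N f hf injf.
have no_fam := finite_no_family (sys_sing (lam := lam) charK hQ hB) hfin.
set L := \matrix_(i, j) l i j in no_fam; set kc := \col_i k i in no_fam.
pose apex := [set j | base_pt (f j) == 0].
have sysf j : j \notin apex -> sing_sys L kc lam q b (base_pt (f j)) (f j ord_max).
  by rewrite inE => x0; case: (sing_sysP charK hQ hB (hf j)) => // -[/eqP]; rewrite (negPf x0).
have apexP j : j \in apex -> lam = 0 /\ f j ord_max != 0.
  rewrite inE => /eqP x0; case: (sing_sysP charK hQ hB (hf j)) => [[] //|[]].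
  by rewrite x0 eqxx.
have fE j i : f j (wd i) = base_pt (f j) i 0 by rewrite mxE.
have apex1 : (#|apex| <= (lam == 0%R))%N.
  have [->|[j0 j0A]] := set_0Vmem apex; first by rewrite cards0.
  have [-> z0] := apexP _ j0A; rewrite eqxx; apply/card_le1P => j jA j'.
  have [_ zj] := apexP _ jA.
  rewrite [RHS]inE; apply/idP/eqP => [j'A|-> //].
  have [_ zj'] := apexP _ j'A.
  apply: injf; exists (f j ord_max / f j' ord_max); first by rewrite mulf_neq0 ?invr_eq0.
  move: jA j'A; rewrite !inE => /eqP xj /eqP xj'.
  by elim/ord4P; rewrite ?fE ?xj ?xj' ?mxE ?mulr0 // mulfVK.
pose T := {j : 'I_N | j \notin apex}.
have NT : N = (#|apex| + #|{: T}|)%N.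
  by rewrite card_sig -[LHS]card_ord -(cardC (mem apex)); congr (_ + _)%N; apply: eq_card.
have hT (j : T) : sing_sys L kc lam q b (base_pt (f (val j))) (f (val j) ord_max).
  by apply: sysf; exact: (valP j).
have injT (j j' : T) c : c != 0 -> base_pt (f (val j')) = c *: base_pt (f (val j)) ->
    f (val j') ord_max = c * f (val j) ord_max -> j = j'.
  move=> c0 e1 e2; apply/val_inj/injf; exists c => //.
  have e i : base_pt (f (val j')) i 0 = c * base_pt (f (val j)) i 0 by rewrite e1 [LHS]mxE.
  by elim/ord4P; rewrite ?fE ?e.
(* With the apex included, the totals are at most [1 + 8] or [0 + 16] for a square quadric and
   [1 + 14] otherwise. *)
have [kc0|kcn] := eqVneq kc 0.
  rewrite kc0 in no_fam hT; have := leq_add apex1 (square_quadric_card charK no_fam hT injT).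
  by rewrite -NT => /leq_trans -> //; case: (lam == 0).
have := leq_add apex1 (nonsquare_quadric_card charK kcn no_fam hT injT).
by rewrite -NT => /leq_trans -> //; case: (lam == 0).
Qed.
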